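(* Let $G$ be a finite group generated by pseudoreflections on $\mathbb{C}^n$ and let $\{\theta_i\}_{i=1}^n$ be a homogeneous system of parameters associated to $G$. Put $\boldsymbol\theta=(\theta_1,\ldots,\theta_n):\mathbb{C}^n\to\mathbb{C}^n$. Then for every $G$-invariant holomorphic function $f$ on $\mathbb{C}^n$ there exists a unique holomorphic function $g$ on $\mathbb{C}^n$ such that $f=g\circ\boldsymbol\theta$.
   Context: A pseudoreflection on $\mathbb{C}^n$ is a linear map $\rho:\mathbb{C}^n\to\mathbb{C}^n$ of finite order in $GL(n,\mathbb{C})$ such that $I_n-\rho$ has rank $1$. A function $f$ on $\mathbb{C}^n$ is $G$-invariant if $f(\rho^{-1}\boldsymbol z)=f(\boldsymbol z)$ for all $\rho\in G$ and $\boldsymbol z\in\mathbb{C}^n$. $\mathbb{C}[\boldsymbol z]=\mathbb{C}[z_1,\ldots,z_n]$ and $\mathbb{C}[\boldsymbol z]^G$ is the ring of $G$-invariant polynomials. A homogeneous system of parameters (hsop, or basic polynomials) associated to $G$ is a family $\{\theta_i\}_{i=1}^n$ of algebraically independent homogeneous $G$-invariant polynomials with $\mathbb{C}[\boldsymbol z]^G=\mathbb{C}[\theta_1,\ldots,\theta_n]$; it exists by the Chevalley-Shephard-Todd theorem. *)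

(* Defs.v *)
From HB Require Import structures.
From mathcomp Require Import all_boot all_order all_algebra.
From mathcomp Require Import complex.
From mathcomp Require Import boolp classical_sets functions cardinality reals.
From mathcomp Require Import topology normedtype derive.
From mathcomp Require mpoly.

Set Implicit Arguments.
Unset Strict Implicit.
Unset Printing Implicit Defensive.

Import Order.TTheory GRing.Theory Num.Theory.
Import numFieldNormedType.Exports.

(* The notations of mpoly clash with those of mathcomp-analysis. *)
Export -(notations) mpoly.

Local Open Scope classical_set_scope.
Local Open Scope ring_scope.

(* Stating the type as a [numClosedFieldType] lets the topology and norm that
   mathcomp-analysis attaches to every numeric field be inferred on it. *)
Definition Cplx (R : realType) : numClosedFieldType := R[i].

Section Defs.
Variables (R : realType) (n : nat).
Local Notation C := (Cplx R).
Local Notation poly_n := (mpoly n C).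

(* A matrix [rho] stands for the linear map [z |-> rho *m z] on columns. *)
Definition pseudoreflection (rho : 'M[C]_n) : Prop :=
  [/\ rho \in unitmx,
      exists2 k : nat, (0 < k)%N & rho ^+ k = 1%:M
    & \rank (1%:M - rho) = 1%N].

Definition matrix_group (G : set 'M[C]_n) : Prop :=
  [/\ forall a, G a -> a \in unitmx,
      G 1%:M,
      forall a b, G a -> G b -> G (a *m b)
    & forall a, G a -> G (invmx a)].

Definition finite_pseudoreflection_group (G : set 'M[C]_n) : Prop :=
  [/\ matrix_group G,
      finite_set G
    & exists2 S : set 'M[C]_n,
        S `<=` pseudoreflection & G = smallest matrix_group S].

Definition G_invariant (G : set 'M[C]_n) (f : 'cV[C]_n -> C) : Prop :=
  forall rho, G rho -> forall z, f (invmx rho *m z) = f z.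

Definition polyfun (p : poly_n) (z : 'cV[C]_n) : C :=
  meval (fun j => z j ord0) p.

Definition invariant_polys (G : set 'M[C]_n) : set poly_n :=
  [set p | G_invariant G (polyfun p)].

Definition algebraically_independent (theta : n.-tuple poly_n) : Prop :=
  forall q : poly_n, comp_mpoly theta q = 0 -> q = 0.

(* A zero [theta_i] would be homogeneous of every degree, but is excluded by
   algebraic independence. *)
Definition hsop (G : set 'M[C]_n) (theta : n.-tuple poly_n) : Prop :=
  [/\ forall i, exists d : nat, tnth theta i \is ishomog1 d mdeg,
      forall i, invariant_polys G (tnth theta i),
      algebraically_independent theta
    & invariant_polys G = range (comp_mpoly theta)].

Definition thetamap (theta : n.-tuple poly_n) (z : 'cV[C]_n) : 'cV[C]_n :=
  \col_i polyfun (tnth theta i) z.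

(* The base field being complex, this is complex Frechet differentiability at
   every point. *)
Definition holomorphic (f : 'cV[C]_n -> C) : Prop :=
  forall z : 'cV[C]_n, differentiable f z.

End Defs.

(* Main.v *)
Require Import Defs.
From mathcomp Require Import all_boot all_order all_algebra.
From HB Require Import structures.
From mathcomp Require Import complex.
From mathcomp Require Import boolp classical_sets functions cardinality reals.
From mathcomp Require Import constructive_ereal topology normedtype sequences.
From mathcomp Require Import landau derive measure lebesgue_measure.
From mathcomp Require Import lebesgue_integral ftc.
From mathcomp Require Import ring lra.

(** Invariant polynomials factor through theta by hypothesis, so the plan is to
    reach an invariant entire function f as a limit of invariant polynomials
    and to pass to the limit downstairs.  Approximate f uniformly on a large
    box by a polynomial [polynomial_approximation] and average over the finite
    group G: the average is an invariant polynomial, hence of the form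
    Q o theta, and it is still close to f [invariant_approximation].  Two facts
    about theta turn this into an approximation of a function on the target.

    - theta is surjective [thetamap_surjective].  The ideal generated by the
      theta_i - c_i is proper: averaging an identity 1 = sum a_i (theta_i - c_i)
      makes the a_i polynomials in theta, algebraic independence then turns it
      into a polynomial identity in the target variables, and at the point c
      that identity reads 1 = 0.  As every coordinate is integral over the
      invariants, a proper ideal of this kind has a zero.

    - theta is proper [thetamap_proper]: z_j is a root of the monic polynomial
      prod_a (X - (a z)_j), whose coefficients are polynomials in theta(z), so
      z is bounded in terms of theta(z).

    Hence g(theta z) := f z is well defined, and on each bounded set it is a
    uniform limit of the polynomials Q.  Such a limit is holomorphic
    [locally_uniform_limit_holomorphic].  Uniqueness of g is surjectivity.

    The complex analysis is developed for functions that are merely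
    differentiable at every point.  Its only tool is the maximum principle on
    squares [max_principle].  Were |h(z)| larger than every value of |h| on the
    boundary, k = 1 - (h / h(z))^m would vanish at z and be nearly 1 on the
    boundary, so that the integral of k(w) / (w - z) around the square would
    have positive imaginary part, as that of 1 / (w - z) has; but the integrand
    is continuous and differentiable off z, and its integral is 0 by Goursat's
    bisection argument.  The maximum principle bounds divided differences, so
    that Newton interpolation at fixed nodes converges geometrically, with a
    rate that depends only on a bound for the function
    [polynomial_interpolation]; since interpolation only uses values of the
    function, it can be applied to the variables one after the other.  The
    maximum principle also bounds the quadratic remainder of a polynomial by
    its values on a larger box, which gives the theorem on limits. *)

Set Implicit Arguments.
Unset Strict Implicit.
Unset Printing Implicit Defensive.

Import Order.TTheory GRing.Theory Num.Theory.
Import numFieldNormedType.Exports.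

Local Open Scope classical_set_scope.
Local Open Scope ring_scope.

(** * Primitives and Goursat's bisection *)

Section Goursat.
Variable R : realType.
Implicit Types (H U V u v : R -> R -> R) (a b c s t x y e : R).

(** The primitive is the integral from a, hence the restriction to x > a. *)
Lemma continuous_primitive (u : R -> R) a : continuous u ->
  exists U : R -> R, forall x, a < x -> is_derive x 1 U (u x).
Proof.
move=> cu.
exists (fun x => \int[lebesgue_measure]_(t in [set` `[a, x]]) u t) => x ax.
have xu : x < x + 1 by rewrite ltrDl.
have iu : (@lebesgue_measure R).-integrable `[a, x + 1] (EFin \o u).
  apply: continuous_compact_integrable; first exact: segment_compact.
  by apply: continuous_subspaceT.
have [du <-] := continuous_FTC1_closed xu iu ax (cu x).
by rewrite derive1E; apply: DeriveDef.
Qed.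

(** If H = U - V with d_y U = Re psi and d_x V = Im psi, this mixed second
    difference is the imaginary part of the integral of psi along the boundary
    of the rectangle with opposite corners (a, c) and (b, d).  Additivity of
    contour integrals under subdivision thus becomes an identity. *)
Definition corner_sum H a b c d := H b d - H a d - H b c + H a c.

(** A positive second difference passes, divided by at most 4, to one of the
    four quarters of the rectangle.  The quarters chosen in this way shrink to
    a point, where the hypothesis makes the second difference too small. *)
Lemma goursat_bisection H x0 w y0 h : 0 <= w -> 0 <= h ->
  (forall p q, x0 <= p <= x0 + w -> y0 <= q <= y0 + h -> forall e, 0 < e ->
    exists2 d, 0 < d & forall a b s t, a <= p <= a + s -> b <= q <= b + t ->
      x0 <= a -> a + s <= x0 + w -> y0 <= b -> b + t <= y0 + h ->
      s <= d -> t <= d ->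
      corner_sum H a (a + s) b (b + t) <= e * (s + t) ^+ 2) ->
  corner_sum H x0 (x0 + w) y0 (y0 + h) <= 0.
Proof.
move=> w0 h0 Hloc; rewrite leNgt; apply/negP => c0.
set c := corner_sum H _ _ _ _ in c0.
pose sc k : R := 2^-1 ^+ k.
have scS k : sc k.+1 = sc k / 2 by rewrite /sc exprSr.
have sc_ge0 k : 0 <= sc k by rewrite exprn_ge0 // invr_ge0 ler0n.
have sc_gt0 k : 0 < sc k by rewrite exprn_gt0 // invr_gt0 ltr0n.
pose good k (z : R * R) :=
  c * sc k ^+ 2 <= corner_sum H z.1 (z.1 + w * sc k) z.2 (z.2 + h * sc k).
(* the four quarters add up to the whole: if the first three are not good,
   the last one is *)
pose step k (z : R * R) : R * R :=
  let u := w * sc k.+1 in let v := h * sc k.+1 in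
  if good k.+1 z then z
  else if good k.+1 (z.1 + u, z.2) then (z.1 + u, z.2)
  else if good k.+1 (z.1, z.2 + v) then (z.1, z.2 + v)
  else (z.1 + u, z.2 + v).
pose z := fix z k := if k is k'.+1 then step k' (z k') else (x0, y0).
have zgood k : good k (z k).
  elim: k => [|k IH]; first by rewrite /good /sc expr0 expr1n !mulr1.
  rewrite /= /step; case: ifP => // /negbT; rewrite -ltNge => n1.
  case: ifP => // /negbT; rewrite -ltNge => n2.
  case: ifP => // /negbT; rewrite -ltNge => n3.
  have e1 r s : r + s * (sc k / 2) + s * (sc k / 2) = r + s * sc k by field.
  have e2 : c * (sc k / 2) ^+ 2 = (c * sc k ^+ 2) / 4 by field.
  move: IH n1 n2 n3; rewrite /good /corner_sum /= !scS !e1 e2; lra.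
have z1 k : (z k).1 <= (z k.+1).1 /\ (z k.+1).1 + w * sc k.+1 <= (z k).1 + w * sc k.
  have W : w * sc k = w * sc k.+1 + w * sc k.+1 by rewrite scS; field.
  have W0 : 0 <= w * sc k.+1 by rewrite mulr_ge0.
  by rewrite W /= /step; do 3 (case: ifP => _ /=; first by lra); lra.
have z2 k : (z k).2 <= (z k.+1).2 /\ (z k.+1).2 + h * sc k.+1 <= (z k).2 + h * sc k.
  have W : h * sc k = h * sc k.+1 + h * sc k.+1 by rewrite scS; field.
  have W0 : 0 <= h * sc k.+1 by rewrite mulr_ge0.
  by rewrite W /= /step; do 3 (case: ifP => _ /=; first by lra); lra.
(* left ends increase and right ends decrease, so that the supremum of the
   left ends lies in all the intervals *)
have nested (u : nat -> R) (l : R) : 0 <= l ->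
    (forall k, u k <= u k.+1 /\ u k.+1 + l * sc k.+1 <= u k + l * sc k) ->
    exists p, forall k, u k <= p <= u k + l * sc k.
  move=> l0 hu.
  have mono k m : u k <= u (k + m)%N /\ u (k + m)%N + l * sc (k + m)%N <= u k + l * sc k.
    elim: m => [|m [IH1 IH2]]; first by rewrite addn0.
    by rewrite addnS; have [h1 h2] := hu (k + m)%N; lra.
  have ub k m : u m <= u k + l * sc k.
    have pos j : 0 <= l * sc j by rewrite mulr_ge0.
    have [/subnKC<-|/ltnW/subnKC<-] := leqP k m.
      by have [_] := mono k (m - k)%N; have := pos (k + (m - k))%N; lra.
    have [+ _] := mono m (k - m)%N; have := pos (m + (k - m))%N; lra.
  exists (sup (range u)) => k; apply/andP; split.
    apply: ub_le_sup; last by exists k.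
    by exists (u 0 + l * sc 0) => _ [m _ <-].
  by apply: ge_sup; [exists (u 0), 0|move=> _ [m _ <-]].
have [p Hp] := nested (fun k => (z k).1) w w0 z1.
have [q Hq] := nested (fun k => (z k).2) h h0 z2.
have x0p : x0 <= p <= x0 + w by have := Hp 0; rewrite /sc expr0 mulr1.
have y0q : y0 <= q <= y0 + h by have := Hq 0; rewrite /sc expr0 mulr1.
(* at step k, (s + t) ^+ 2 is (w + h) ^+ 2 / 4 ^ k; adding 1 makes the
   comparison strict *)
have D0 : 0 < (w + h) ^+ 2 + 1 by have := sqr_ge0 (w + h); lra.
have [d d0 Hd] := Hloc p q x0p y0q (c / ((w + h) ^+ 2 + 1)) (divr_gt0 c0 D0).
have [k Hk] : exists k, (w + h) * sc k <= d.
  have [->|/eqP wh0] := eqVneq (w + h) 0; first by exists 0; rewrite mul0r ltW.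
  have whp : 0 < w + h by lra.
  have : exists k, sc k < d / (w + h).
    have : sc @ \oo --> 0 by apply: cvg_expr; rewrite ger0_norm; lra.
    move/cvgrPdist_lt => /(_ (d / (w + h))); rewrite divr_gt0// => /(_ isT) [k _ Hk].
    by exists k; have := Hk k (leqnn k); rewrite /= sub0r normrN ger0_norm.
  move=> [k Hk]; exists k; move: Hk; rewrite ltr_pdivlMr// mulrC => /ltW//.
have inb k' : x0 <= (z k').1 /\ (z k').1 + w * sc k' <= x0 + w /\
             y0 <= (z k').2 /\ (z k').2 + h * sc k' <= y0 + h.
  elim: k' => [|j [i1 [i2 [i3 i4]]]]; first by rewrite /sc expr0 !mulr1 /=; lra.
  by have := z1 j; have := z2 j; lra.
have [i1 [i2 [i3 i4]]] := inb k.
have wk0 : 0 <= w * sc k by rewrite mulr_ge0.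
have hk0 : 0 <= h * sc k by rewrite mulr_ge0.
have := Hd (z k).1 (z k).2 (w * sc k) (h * sc k) (Hp k) (Hq k) i1 i2 i3 i4.
have s1 : w * sc k <= d by lra.
have s2 : h * sc k <= d by lra.
move=> /(_ s1 s2); apply/negP; rewrite -ltNge.
apply: lt_le_trans (zgood k).
rewrite -mulrDl exprMn mulrA ltr_pM2r; last exact: exprn_gt0 (sc_gt0 k).
rewrite mulrAC ltr_pdivrMr// ltr_pM2l//; lra.
Qed.

Lemma increment_mean (F f : R -> R) a s : 0 <= s ->
  (forall x, a <= x -> is_derive x 1 F (f x)) ->
  exists2 x, a <= x <= a + s & F (a + s) - F a = f x * s.
Proof.
move=> s0 dF.
have [||c|c cin ->] := @MVT_segment R F f a (a + s); first by rewrite lerDl.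
- by move=> x; rewrite in_itv /= => /andP[/ltW ax _]; apply: dF.
- apply: derivable_within_continuous => x; rewrite in_itv /= => /andP[ax _].
  by have [] := dF x ax.
- by exists c; [move: cin; rewrite in_itv|congr (_ * _); ring].
Qed.

(** The mean value theorem for the differences of opposite sides.  Only
    increments of u and v across the rectangle enter. *)
Lemma corner_sum_mean U V u v l a s b t : l < a -> l < b -> 0 <= s -> 0 <= t ->
  (forall x y, l < y -> is_derive y 1 (U x) (u x y)) ->
  (forall x y, l < x -> is_derive x 1 (V ^~ y) (v x y)) ->
  exists x y, [/\ a <= x <= a + s, b <= y <= b + t &
    corner_sum (fun x y => U x y - V x y) a (a + s) b (b + t) =
    (u (a + s) y - u a y) * t - (v x (b + t) - v x b) * s].
Proof.
move=> la lb s0 t0 dU dV.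
have dUB y : b <= y -> is_derive y 1 (fun y => U (a + s) y - U a y)
    (u (a + s) y - u a y).
  move=> /(lt_le_trans lb) ly.
  by have d1 := dU (a + s) y ly; have d2 := dU a y ly; apply: is_deriveB.
have dVB x : a <= x -> is_derive x 1 (fun x => V x (b + t) - V x b)
    (v x (b + t) - v x b).
  move=> /(lt_le_trans la) lx.
  by have d1 := dV x (b + t) lx; have d2 := dV x b lx; apply: is_deriveB.
have [y yb Ey] := increment_mean t0 dUB.
have [x xb Ex] := increment_mean s0 dVB.
exists x, y; split=> //; rewrite -Ey -Ex /corner_sum; ring.
Qed.

End Goursat.

(** * Complex numbers over a real field *)

Section Modulus.
Variable R : realType.
Local Notation C := (Cplx R).
Implicit Types (z w : C) (x y : R).

Definition cplx (x y : R) : C := Complex x y.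
(** The norm of a numeric field is valued in the field; this is its value as a
    real number, for which linear arithmetic is available. *)
Definition cabs z : R := complex.Re (`|z| : R[i]).
Definition cre z : R := complex.Re (z : R[i]).
Definition cim z : R := complex.Im (z : R[i]).
Definition ofR (x : R) : C := cplx x 0.

Lemma cabsE z : `|z| = ofR (cabs z).
Proof. by rewrite /cabs; case: z => a b. Qed.

Lemma le_ofR x y : (ofR x <= ofR y) = (x <= y). Proof. exact: lecR. Qed.
Lemma lt_ofR x y : (ofR x < ofR y) = (x < y). Proof. exact: ltcR. Qed.

Lemma gt0_ofR e : 0 < e -> e = ofR (cre e) /\ 0 < cre e.
Proof. by case: e => a b; rewrite ltcE /= => /andP[/eqP -> ?]; split. Qed.

Lemma creD z w : cre (z + w) = cre z + cre w. Proof. by case: z w => ? ? []. Qed.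
Lemma cimD z w : cim (z + w) = cim z + cim w. Proof. by case: z w => ? ? []. Qed.
Lemma creN z : cre (- z) = - cre z. Proof. by case: z. Qed.
Lemma cimN z : cim (- z) = - cim z. Proof. by case: z. Qed.
Lemma creB z w : cre (z - w) = cre z - cre w. Proof. by rewrite creD creN. Qed.
Lemma cimB z w : cim (z - w) = cim z - cim w. Proof. by rewrite cimD cimN. Qed.
Lemma creM z w : cre (z * w) = cre z * cre w - cim z * cim w.
Proof. by case: z w => ? ? []. Qed.
Lemma cimM z w : cim (z * w) = cre z * cim w + cim z * cre w.
Proof. by case: z w => ? ? []. Qed.
Lemma cplxE z : z = cplx (cre z) (cim z). Proof. by case: z. Qed.

Lemma cabs_ge0 z : 0 <= cabs z.
Proof. by rewrite -le_ofR -cabsE normr_ge0. Qed.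

Lemma cre_le_cabs z : `|cre z| <= cabs z.
Proof. by rewrite -le_ofR -cabsE; apply: normc_ge_Re. Qed.

Lemma cim_le_cabs z : `|cim z| <= cabs z.
Proof.
rewrite -le_ofR -cabsE; case: z => a b; rewrite normc_def /= lecR.
by rewrite -sqrtr_sqr ler_wsqrtr // lerDr sqr_ge0.
Qed.

Lemma cabs_le_parts z : cabs z <= `|cre z| + `|cim z|.
Proof.
rewrite -le_ofR -cabsE; case: z => a b; rewrite normc_def /= lecR.
rewrite -(@ler_pXn2r _ 2) ?nnegrE ?sqrtr_ge0 ?addr_ge0 ?normr_ge0 //.
rewrite sqr_sqrtr ?addr_ge0 ?sqr_ge0 //.
rewrite -(real_normK (num_real a)) -(real_normK (num_real b)).
by have := normr_ge0 a; have := normr_ge0 b; rewrite /cre /cim /=; nra.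
Qed.

Lemma cabsM z w : cabs (z * w) = cabs z * cabs w.
Proof. by have := normrM z w; rewrite !cabsE /ofR /cplx; simpc => -[]. Qed.

Lemma ofR_gt0 (x : R) : 0 < x -> 0 < ofR x. Proof. by rewrite -lt_ofR. Qed.

Lemma ofRM (x y : R) : ofR (x * y) = ofR x * ofR y.
Proof. by rewrite /ofR /cplx; simpc. Qed.

Lemma cabsX z n : cabs (z ^+ n) = cabs z ^+ n.
Proof.
elim: n => [|n IH]; last by rewrite !exprS cabsM IH.
by rewrite !expr0; apply: (@complexI R); rewrite -[LHS]/(ofR (cabs 1)) -cabsE normr1.
Qed.

Lemma cabs_eq0 z : (cabs z == 0) = (z == 0).
Proof.
rewrite -[z == 0]normr_eq0 cabsE; apply/eqP/eqP => [->//|].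
by move/(congr1 cre).
Qed.

Lemma cabs_gt0 z : (0 < cabs z) = (z != 0).
Proof. by rewrite lt_neqAle cabs_ge0 andbT eq_sym cabs_eq0. Qed.

Lemma cabsB z w : cabs (z - w) <= cabs z + cabs w.
Proof.
rewrite -le_ofR; have -> : ofR (cabs z + cabs w) = `|z| + `|w|.
  by rewrite !cabsE /ofR /cplx; simpc.
by rewrite -cabsE; apply: ler_normB.
Qed.

Lemma cabsD z w : cabs (z + w) <= cabs z + cabs w.
Proof.
rewrite -le_ofR; have -> : ofR (cabs z + cabs w) = `|z| + `|w|.
  by rewrite !cabsE /ofR /cplx; simpc.
by rewrite -cabsE; apply: ler_normD.
Qed.

Lemma cabsN z : cabs (- z) = cabs z.
Proof. by apply: (@complexI R); rewrite -[LHS]/(ofR (cabs (- z))) -cabsE normrN cabsE. Qed.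

Lemma cabs_ofR (x : R) : 0 <= x -> cabs (ofR x) = x.
Proof.
move=> x0; apply: (@complexI R); rewrite -[LHS]/(ofR (cabs (ofR x))) -cabsE ger0_norm //.
by rewrite (_ : 0 = ofR 0) // le_ofR.
Qed.

Lemma cabs_div z w : cabs (z / w) = cabs z / cabs w.
Proof.
rewrite cabsM; congr (_ * _).
by apply: (@complexI R); rewrite fmorphV -[LHS]/(ofR (cabs w^-1)) -cabsE normfV cabsE.
Qed.

Lemma cabs_sum (N : nat) (f : 'I_N -> C) : cabs (\sum_j f j) <= \sum_j cabs (f j).
Proof.
elim/big_ind2: _ => [|x1 x2 y1 y2 h1 h2|//]; first by rewrite le_eqVlt cabs_eq0 eqxx.
by apply: le_trans (cabsD _ _) (lerD h1 h2).
Qed.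

End Modulus.

(** * Flux of a differentiable function around a rectangle *)

Section Flux.
Variable R : realType.
Local Notation C := (Cplx R).
Implicit Types (z w : C) (h psi : C -> C) (r x y p q : R).

Lemma continuous_cim_row psi y : continuous psi ->
  continuous (fun x : R => cim (psi (cplx x y))).
Proof.
move=> cpsi x; apply/cvgrPdist_le => e e0.
have /cvgrPdist_le/(_ _ (ofR_gt0 e0)) := cpsi (cplx x y).
move=> /nbhs_ballP [d d0 Hd]; have [dE d0'] := gt0_ofR d0.
apply/nbhs_ballP; exists (cre d) => // t; rewrite /ball /= => xt.
rewrite -cimB; apply: le_trans (cim_le_cabs _) _; rewrite -le_ofR -cabsE; apply: Hd.
rewrite /ball /= dE cabsE lt_ofR; apply: le_lt_trans (cabs_le_parts _) _.
by rewrite creB cimB /cre /cim /= subrr normr0 addr0.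
Qed.

Lemma continuous_cre_column psi x : continuous psi ->
  continuous (fun y : R => cre (psi (cplx x y))).
Proof.
move=> cpsi y; apply/cvgrPdist_le => e e0.
have /cvgrPdist_le/(_ _ (ofR_gt0 e0)) := cpsi (cplx x y).
move=> /nbhs_ballP [d d0 Hd]; have [dE d0'] := gt0_ofR d0.
apply/nbhs_ballP; exists (cre d) => // t; rewrite /ball /= => xt.
rewrite -creB; apply: le_trans (cre_le_cabs _) _; rewrite -le_ofR -cabsE; apply: Hd.
rewrite /ball /= dE cabsE lt_ofR; apply: le_lt_trans (cabs_le_parts _) _.
by rewrite creB cimB /cre /cim /= subrr normr0 add0r.
Qed.

Lemma differentiable_linear_approx h z : differentiable h z ->
  exists a : C, forall e : R, 0 < e -> exists2 d : R, 0 < d & forall w,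
    cabs (w - z) <= d -> cabs (h w - h z - a * (w - z)) <= e * cabs (w - z).
Proof.
move=> dh; exists ('d h z (1 : C)) => e e0.
have /eqaddoP/(_ _ (ofR_gt0 e0)) := diff_locally dh.
move=> /nbhs_ballP [d d0 Hd]; have [dE d0'] := gt0_ofR d0.
exists (cre d / 2); first lra.
move=> w wz; rewrite -le_ofR -cabsE.
have -> : ofR (e * cabs (w - z)) = ofR e * `|w - z|.
  by rewrite cabsE /ofR /cplx; simpc.
have -> : 'd h z (1 : C) * (w - z) = 'd h z (w - z).
  by rewrite -[in RHS](mulr1 (w - z)) -[(w - z) * 1]/((w - z) *: (1 : C)) linearZ mulrC.
have := Hd (w - z); rewrite /ball /= sub0r normrN cabsE dE lt_ofR.
have -> : cabs (w - z) < cre d by lra.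
by move/(_ isT); rewrite -[(_ - _ : C -> C) _]/(h (w - z + z) - (h z + 'd h z (w - z))) subrK opprD addrA.
Qed.

(** The derivative al contributes Re al * s to the increment of Re psi and
    Re al * t to that of Im psi, by the Cauchy-Riemann equations; these cancel
    in the second difference, and only the error of the linear approximation
    remains. *)
Lemma corner_sum_local psi (U V : R -> R -> R) (l p q : R) :
  (forall x y : R, l < y -> is_derive y 1 (U x) (cre (psi (cplx x y)))) ->
  (forall x y : R, l < x -> is_derive x 1 (V ^~ y) (cim (psi (cplx x y)))) ->
  differentiable psi (cplx p q) -> forall e, 0 < e ->
  exists2 d, 0 < d & forall a b s t, l < a -> l < b ->
    a <= p <= a + s -> b <= q <= b + t -> s <= d -> t <= d ->
    corner_sum (fun x y => U x y - V x y) a (a + s) b (b + t) <= e * (s + t) ^+ 2.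
Proof.
move=> dU dV /differentiable_linear_approx [al Hal] e e0.
have [d d0 Hd] := Hal (e / 2) (divr_gt0 e0 (ltr0Sn _ _)).
exists (d / 2); first lra.
move=> a b s t la lb /andP[ap pas] /andP[bq qbt] sd td.
have near_pt X Y : a <= X <= a + s -> b <= Y <= b + t ->
    `|cre (psi (cplx X Y)) - cre (psi (cplx p q)) - (cre al * (X - p) - cim al * (Y - q))|
      <= e / 2 * (s + t) /\
    `|cim (psi (cplx X Y)) - cim (psi (cplx p q)) - (cre al * (Y - q) + cim al * (X - p))|
      <= e / 2 * (s + t).
  move=> /andP[aX Xs] /andP[bY Yt].
  have st : cabs (cplx X Y - cplx p q) <= s + t.
    apply: le_trans (cabs_le_parts _) _; rewrite creB cimB /cre /cim /=.
    by apply: lerD; rewrite ler_norml; apply/andP; split; lra.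
  have /Hd Hw : cabs (cplx X Y - cplx p q) <= d by apply: le_trans st _; lra.
  have Hw' : cabs (psi (cplx X Y) - psi (cplx p q) - al * (cplx X Y - cplx p q))
      <= e / 2 * (s + t).
    by apply: le_trans Hw _; rewrite ler_wpM2l // divr_ge0 // ltW.
  split; [apply: le_trans Hw'; apply: le_trans (cre_le_cabs _)
         |apply: le_trans Hw'; apply: le_trans (cim_le_cabs _)].
    by rewrite !creB creM creB cimB.
  by rewrite !cimB cimM creB cimB.
have s0 : 0 <= s by lra.
have t0 : 0 <= t by lra.
have [x [y [/andP[x1 x2] /andP[y1 y2] ->]]] := corner_sum_mean la lb s0 t0 dU dV.
have [r1 _] : _ /\ _ := near_pt (a + s) y ltac:(lra) ltac:(lra).
have [r2 _] : _ /\ _ := near_pt a y ltac:(lra) ltac:(lra).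
have [_ r3] : _ /\ _ := near_pt x (b + t) ltac:(lra) ltac:(lra).
have [_ r4] : _ /\ _ := near_pt x b ltac:(lra) ltac:(lra).
move: r1 r2 r3 r4; rewrite !ler_norml.
set A1 := cre (psi _); set A0 := cre (psi _); set A2 := cre (psi _).
set B1 := cim (psi _); set B0 := cim (psi _); set B2 := cim (psi _).
move=> /andP[_ r1] /andP[r2 _] /andP[r3 _] /andP[_ r4].
have hu : A1 - A2 <= cre al * s + e * (s + t) by lra.
have hv : - (B1 - B2) <= - (cre al * t) + e * (s + t) by lra.
have -> : (A1 - A2) * t - (B1 - B2) * s = (A1 - A2) * t + - (B1 - B2) * s by ring.
have h1 := ler_wpM2r t0 hu; have h2 := ler_wpM2r s0 hv.
apply: le_trans (lerD h1 h2) _.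
suff -> : (cre al * s + e * (s + t)) * t + (- (cre al * t) + e * (s + t)) * s =
  e * (s + t) ^+ 2 by [].
by ring.
Qed.

Lemma corner_sum_le0 psi (U V : R -> R -> R) (l a b c d : R) :
  (forall x y : R, l < y -> is_derive y 1 (U x) (cre (psi (cplx x y)))) ->
  (forall x y : R, l < x -> is_derive x 1 (V ^~ y) (cim (psi (cplx x y)))) ->
  l < a -> l < c -> a <= b -> c <= d ->
  (forall p q, a <= p <= b -> c <= q <= d -> differentiable psi (cplx p q)) ->
  corner_sum (fun x y => U x y - V x y) a b c d <= 0.
Proof.
move=> dU dV la lc ab cd dpsi.
have eb : b = a + (b - a) by rewrite addrC subrK.
have ed : d = c + (d - c) by rewrite addrC subrK.
rewrite eb ed; apply: goursat_bisection; rewrite ?subr_ge0 -?eb -?ed //.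
move=> p q ap cq e e0.
have [m m0 Hm] := corner_sum_local dU dV (dpsi p q ap cq) e0.
exists m => // x y s t xp yq ax _ cy _ sm tm.
by apply: Hm => //; [apply: lt_le_trans ax|apply: lt_le_trans cy].
Qed.

Lemma corner_sum_le_bound psi (U V : R -> R -> R) (l a b c d K : R) :
  (forall x y : R, l < y -> is_derive y 1 (U x) (cre (psi (cplx x y)))) ->
  (forall x y : R, l < x -> is_derive x 1 (V ^~ y) (cim (psi (cplx x y)))) ->
  l < a -> l < c -> a <= b -> c <= d ->
  (forall p q, a <= p <= b -> c <= q <= d -> cabs (psi (cplx p q)) <= K) ->
  corner_sum (fun x y => U x y - V x y) a b c d <= 2 * K * (d - c + (b - a)).
Proof.
move=> dU dV la lc ab cd bd.
have ba0 : 0 <= b - a by rewrite subr_ge0.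
have dc0 : 0 <= d - c by rewrite subr_ge0.
have [x [y []]] := corner_sum_mean la lc ba0 dc0 dU dV.
rewrite !subrKC => xr yr ->.
have aa : a <= a <= b by rewrite lexx.
have bb : a <= b <= b by rewrite lexx ab.
have cc : c <= c <= d by rewrite lexx.
have dd : c <= d <= d by rewrite lexx cd.
have hu p q : a <= p <= b -> c <= q <= d -> `|cre (psi (cplx p q))| <= K.
  by move=> ap cq; apply: le_trans (cre_le_cabs _) (bd p q ap cq).
have hv p q : a <= p <= b -> c <= q <= d -> `|cim (psi (cplx p q))| <= K.
  by move=> ap cq; apply: le_trans (cim_le_cabs _) (bd p q ap cq).
have := hu b y bb yr; have := hu a y aa yr.
have := hv x d xr dd; have := hv x c xr cc.
rewrite !ler_norml => /andP[b1 b2] /andP[b3 b4] /andP[a1 a2] /andP[a3 a4].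
rewrite [leRHS]mulrDr -[X in _ + X <= _]mulNr.
by apply: lerD; apply: ler_wpM2r => //; lra.
Qed.

Lemma corner_sum_excise (H : R -> R -> R) x1 x2 x3 x4 y1 y2 y3 y4 :
  corner_sum H x1 x4 y1 y4 =
  corner_sum H x1 x2 y1 y4 + corner_sum H x3 x4 y1 y4 +
  corner_sum H x2 x3 y1 y2 + corner_sum H x2 x3 y3 y4 +
  corner_sum H x2 x3 y2 y3.
Proof. by rewrite /corner_sum; ring. Qed.

(** A point where psi is only continuous is cut out in a small square.  The
    four rectangles around it contribute nothing positive, and the square at
    most a constant times its side. *)
Lemma corner_sum_le0_punctured psi (U V : R -> R -> R) l z a b c d :
  (forall x y : R, l < y -> is_derive y 1 (U x) (cre (psi (cplx x y)))) ->
  (forall x y : R, l < x -> is_derive x 1 (V ^~ y) (cim (psi (cplx x y)))) ->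
  l < a -> l < c -> {for z, continuous psi} ->
  (forall w, w != z -> differentiable psi w) ->
  a < cre z < b -> c < cim z < d ->
  corner_sum (fun x y => U x y - V x y) a b c d <= 0.
Proof.
move=> dU dV la lc cpsi dpsi /andP[az zb] /andP[cz zd].
have [K K0 [m0 m0_gt0 Hm]] : exists2 K : R, 0 < K & exists2 m : R, 0 < m & forall x y,
    `|x - cre z| <= m -> `|y - cim z| <= m -> cabs (psi (cplx x y)) <= K.
  have /(@cvgrPdist_le C C _ (nbhs z) (nbhs_filter z))/(_ 1 ltr01) := cpsi.
  move=> /nbhs_ballP [e e0 He]; have [eE e0'] := gt0_ofR e0.
  exists (cabs (psi z) + 1); first by rewrite ltr_wpDl ?cabs_ge0.
  exists (cre e / 3); first by rewrite divr_gt0.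
  move=> x y xz yz; rewrite -le_ofR -cabsE.
  have -> : ofR (cabs (psi z) + 1) = `|psi z| + 1 by rewrite cabsE /ofR /cplx; simpc.
  rewrite -lerBlDl; apply: le_trans (lerB_dist _ _) _.
  rewrite distrC; apply: He; rewrite /ball /= distrC eE cabsE lt_ofR.
  apply: le_lt_trans (cabs_le_parts _) _.
  by rewrite creB cimB [cre (cplx _ _)]/= [cim (cplx _ _)]/=; lra.
pose H x y := U x y - V x y; rewrite -/H.
have away a' b' c' d' : l < a' -> l < c' -> a' <= b' -> c' <= d' ->
    (forall p q, a' <= p <= b' -> c' <= q <= d' -> p != cre z \/ q != cim z) ->
    corner_sum H a' b' c' d' <= 0.
  move=> la' lc' ab cd out; apply: (corner_sum_le0 dU dV la' lc' ab cd) => p q ap cq.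
  apply: dpsi; apply/negP => /eqP zE.
  by case: (out p q ap cq); rewrite -zE /= eqxx.
have small m : 0 < m -> m <= m0 -> m <= cre z - a -> m <= b - cre z ->
    m <= cim z - c -> m <= d - cim z -> corner_sum H a b c d <= 8 * K * m.
  move=> mg mm ma mb mc md.
  have x1 : a <= cre z - m by rewrite lerBrDr addrC -lerBrDr.
  have x2 : cre z - m < cre z by rewrite ltrBlDr ltrDl.
  have x3 : cre z < cre z + m by rewrite ltrDl.
  have x4 : cre z + m <= b by rewrite addrC -lerBrDr.
  have y1 : c <= cim z - m by rewrite lerBrDr addrC -lerBrDr.
  have y2 : cim z - m < cim z by rewrite ltrBlDr ltrDl.
  have y3 : cim z < cim z + m by rewrite ltrDl.
  have y4 : cim z + m <= d by rewrite addrC -lerBrDr.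
  have x23 := ltW (lt_trans x2 x3); have y23 := ltW (lt_trans y2 y3).
  have cd := ltW (lt_trans cz zd).
  have lx1 := lt_le_trans la x1; have ly1 := lt_le_trans lc y1.
  have lx3 := lt_le_trans lx1 x23; have ly3 := lt_le_trans ly1 y23.
  rewrite (corner_sum_excise H a (cre z - m) (cre z + m) b c (cim z - m) (cim z + m) d).
  have E1 : corner_sum H a (cre z - m) c d <= 0.
    apply: away => // p q /andP[_ p2] _; left.
    by rewrite lt_eqF // (le_lt_trans p2).
  have E2 : corner_sum H (cre z + m) b c d <= 0.
    apply: away => // p q /andP[p1 _] _; left.
    by rewrite gt_eqF // (lt_le_trans x3).
  have E3 : corner_sum H (cre z - m) (cre z + m) c (cim z - m) <= 0.
    apply: away => // p q _ /andP[_ q2]; right.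
    by rewrite lt_eqF // (le_lt_trans q2).
  have E4 : corner_sum H (cre z - m) (cre z + m) (cim z + m) d <= 0.
    apply: away => // p q _ /andP[q1 _]; right.
    by rewrite gt_eqF // (lt_le_trans y3).
  have E5 : corner_sum H (cre z - m) (cre z + m) (cim z - m) (cim z + m) <=
      2 * K * ((cim z + m) - (cim z - m) + ((cre z + m) - (cre z - m))).
    apply: (corner_sum_le_bound dU dV) => // p q /andP[p1 p2] /andP[q1 q2].
    apply: Hm; apply: le_trans mm; rewrite ler_norml; apply/andP; split.
    - by rewrite lerBrDr addrC.
    - by rewrite lerBlDr addrC.
    - by rewrite lerBrDr addrC.
    - by rewrite lerBlDr addrC.
  have -> : 8 * K * m = 0 + 0 + 0 + 0 +
      2 * K * ((cim z + m) - (cim z - m) + ((cre z + m) - (cre z - m))) by ring.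
  by apply: lerD E5; apply: lerD E4; apply: lerD E3; apply: lerD E1 E2.
rewrite leNgt; apply/negP => S0; set S := corner_sum H a b c d in small S0.
pose m := Num.min (Num.min m0 (S / (16 * K))) (Num.min (Num.min (cre z - a) (b - cre z))
            (Num.min (cim z - c) (d - cim z))).
have m_gt0 : 0 < m by rewrite !lt_min m0_gt0 divr_gt0 ?mulr_gt0 // !subr_gt0 az zb cz zd.
have mS : 8 * K * m <= S / 2.
  have : m <= S / (16 * K) by rewrite /m !ge_min lexx orbT.
  rewrite ler_pdivlMr ?mulr_gt0 // => h.
  have -> : 8 * K * m = (m * (16 * K)) / 2 by field.
  by rewrite ler_pM2r // invr_gt0 ltr0n.
have [m1 m2 m3 m4 m5] : [/\ m <= m0, m <= cre z - a, m <= b - cre z,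
    m <= cim z - c & m <= d - cim z].
  by split; rewrite /m !ge_min lexx ?orbT.
have := small m m_gt0 m1 m2 m3 m4 m5.
by apply/negP; rewrite -ltNge (le_lt_trans mS) // ltr_pdivrMr // ltr_pMr // ltr1n.
Qed.

(** The imaginary part of the contour integral of psi is the integral of Re psi
    over the right side and of Im psi over the bottom, minus the integrals over
    the opposite sides: with these signs it would be positive. *)
Lemma no_positive_flux psi z r : continuous psi ->
  (forall w, w != z -> differentiable psi w) ->
  `|cre z| < r -> `|cim z| < r ->
  (forall y, `|y| <= r -> 0 < cre (psi (cplx r y))) ->
  (forall y, `|y| <= r -> cre (psi (cplx (- r) y)) < 0) ->
  (forall x, `|x| <= r -> cim (psi (cplx x r)) < 0) ->
  (forall x, `|x| <= r -> 0 < cim (psi (cplx x (- r)))) -> False.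
Proof.
move=> cpsi dpsi zx zy right left top bot.
have r0 : 0 < r by apply: le_lt_trans zx.
move: zx zy; rewrite !ltr_norml => zx zy.
pose l := - r - 1; have lr : l < - r by rewrite /l ltrBlDr ltrDl.
have [U dU] := @boolp.choice R (R -> R) (fun x u => forall y : R, l < y ->
    is_derive y 1 u (cre (psi (cplx x y))))
  (fun x => continuous_primitive l (continuous_cre_column (x := x) cpsi)).
have [V' dV'] := @boolp.choice R (R -> R) (fun y u => forall x : R, l < x ->
    is_derive x 1 u (cim (psi (cplx x y))))
  (fun y => continuous_primitive l (continuous_cim_row (y := y) cpsi)).
pose V (x y : R) := V' y x.
have dV (x y : R) : l < x -> is_derive x 1 (V ^~ y) (cim (psi (cplx x y))) by apply: dV'.
have := corner_sum_le0_punctured dU dV lr lr (cpsi z) dpsi zx zy.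
apply/negP; rewrite -ltNge.
have rr : 0 <= r + r by rewrite addr_ge0 // ltW.
have rr0 : 0 < r + r by rewrite addr_gt0.
have [x [y []]] := corner_sum_mean lr lr rr rr dU dV.
rewrite addKr -!ler_norml => xr yr ->.
rewrite subr_gt0; apply: (@lt_trans _ _ 0); rewrite ?pmulr_llt0 ?pmulr_lgt0 //.
  by rewrite subr_lt0 (lt_trans (top x xr)) ?bot.
by rewrite subr_gt0 (lt_trans (left y yr)) ?right.
Qed.

End Flux.

(** * The maximum principle *)

Section MaxPrinciple.
Variable R : realType.
Local Notation C := (Cplx R).
Implicit Types (z w : C) (h k : C -> C) (S : seq C) (r x y p q : R).

(** Squares take the place of discs because their boundaries consist of
    horizontal and vertical segments. *)
Definition in_square r z := (`|cre z| <= r) && (`|cim z| <= r).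

Definition on_square r z :=
  in_square r z && ((`|cre z| == r) || (`|cim z| == r)).

Lemma in_square_cabs r z : in_square r z -> cabs z <= 2 * r.
Proof. by move=> /andP[h1 h2]; apply: le_trans (cabs_le_parts z) _; lra. Qed.

Lemma in_square_of_cabs r w : cabs w <= r -> in_square r w.
Proof. by move=> h; apply/andP; split; apply: le_trans h; [apply: cre_le_cabs|apply: cim_le_cabs]. Qed.

(** The value a is meant to be the derivative of h at z. *)
Definition divdiff h z (a : C) w : C := if w == z then a else (h w - h z) / (w - z).

Lemma divdiffE h z a w : w != z -> divdiff h z a w = (h w - h z) / (w - z).
Proof. by rewrite /divdiff => /negbTE ->. Qed.

Lemma divdiff_differentiable h z a w : w != z -> differentiable h w ->
  differentiable (divdiff h z a) w.
Proof.
move=> wz dh.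
have dq : differentiable (fun w => (h w - h z) * (w - z)^-1) w.
  apply: differentiableM.
    by apply: differentiableB => //; apply: differentiable_cst.
  apply: differentiableV; last by rewrite subr_eq0.
  by apply: differentiableB.
apply/derivable1_diffP; move/derivable1_diffP in dq.
apply: near_eq_derivable dq.
have : 0 < `|w - z| by rewrite normr_gt0 subr_eq0.
move=> d0; apply/nbhs_ballP; exists `|w - z| => // t; rewrite /ball /= => wt.
by rewrite divdiffE //; apply: contraTneq wt => ->; rewrite ltxx.
Qed.

Lemma divdiff_continuous_at h z : differentiable h z ->
  exists a, {for z, continuous (divdiff h z a)}.
Proof.
move=> /differentiable_linear_approx [a Ha]; exists a.
apply/(@cvgrPdist_le C C _ (nbhs z) (nbhs_filter z)) => e e0; have [eE e0'] := gt0_ofR e0.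
have [d d0 Hd] := Ha _ e0'.
apply/nbhs_ballP; exists (ofR d); first exact: ofR_gt0.
move=> w; rewrite /ball /= distrC cabsE lt_ofR => /ltW wz.
rewrite /divdiff eqxx; case: eqVneq => [_|nz]; first by rewrite subrr normr0 ltW.
have wz0 : w - z != 0 by rewrite subr_eq0.
rewrite distrC -(ler_pM2r (x := `|w - z|)) ?normr_gt0 // -normrM mulrBl divfK //.
rewrite [X in X <= _]cabsE [X in _ <= _ * X]cabsE eE; have := Hd w wz; rewrite -le_ofR.
by rewrite [X in _ <= X](_ : _ = ofR (cre e) * ofR (cabs (w - z))) // /ofR /cplx; simpc.
Qed.

(** Dividing out z costs differentiability at z, but not continuity.  The
    exceptional sets S below record the points divided out so far. *)
Lemma divdiff_regular h (S : seq C) z : continuous h ->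
  (forall w, w \notin S -> differentiable h w) -> z \notin S ->
  exists a, continuous (divdiff h z a) /\
    forall w, w \notin z :: S -> differentiable (divdiff h z a) w.
Proof.
move=> ch dh zS; have [a ca] := divdiff_continuous_at (dh z zS).
exists a; split=> w.
  have [->//|wz] := eqVneq w z.
  pose q : C -> C := fun w => (h w - h z) * (w - z)^-1.
  have cq : {for w, continuous q}.
    apply: (@continuousM C C (h - cst (h z)) (fun w => (w - z)^-1)).
      exact: (@continuousB C C C h (cst (h z)) w (ch w) (@cst_continuous _ _ _ _)).
    apply: (@continuousV C C (id - cst z)); first by rewrite subr_eq0.
    exact: (@continuousB C C C id (cst z) w (@cvg_id _ _) (@cst_continuous _ _ _ _)).
  have nq : \forall t \near nbhs w, divdiff h z a t = q t.
    have d0 : 0 < `|w - z| by rewrite normr_gt0 subr_eq0.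
    apply/nbhs_ballP; exists `|w - z| => // t; rewrite /ball /= => wt.
    by rewrite divdiffE //; apply: contraTneq wt => ->; rewrite ltxx.
  have qw : q w = divdiff h z a w by rewrite divdiffE.
  suff : divdiff h z a @ w --> q w by rewrite qw.
  apply/(@cvgrPdist_le C C _ (nbhs w) (nbhs_filter w)) => e e0.
  have /(@cvgrPdist_le C C _ (nbhs w) (nbhs_filter w))/(_ e e0) := cq.
  by apply: filterS2 nq => t ->.
rewrite in_cons negb_or => /andP[wz wS]; exact (divdiff_differentiable a wz (dh w wS)).
Qed.

Lemma cre_div c w : w != 0 ->
  cre (c / w) * (cre w ^+ 2 + cim w ^+ 2) = cre c * cre w + cim c * cim w.
Proof.
move=> w0; have {2 3}-> : c = c / w * w by rewrite divfK.
by move: (c / w) => q; rewrite creM cimM; ring.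
Qed.

Lemma cim_div c w : w != 0 ->
  cim (c / w) * (cre w ^+ 2 + cim w ^+ 2) = cim c * cre w - cre c * cim w.
Proof.
move=> w0; have {2 3}-> : c = c / w * w by rewrite divfK.
by move: (c / w) => q; rewrite creM cimM; ring.
Qed.

Lemma normsq_gt0 z : z != 0 -> 0 < cre z ^+ 2 + cim z ^+ 2.
Proof.
move=> z0; rewrite lt_neqAle addr_ge0 ?sqr_ge0 // andbT eq_sym.
apply: contra z0; rewrite paddr_eq0 ?sqr_ge0 // !sqrf_eq0 => /andP[/eqP h1 /eqP h2].
by rewrite (cplxE z) h1 h2.
Qed.

(** Otherwise k (w) / (w - z), completed by the derivative of k at z, would have
    on the boundary the signs of 1 / (w - z), against [no_positive_flux]. *)
Lemma zero_not_nearly_one k z r d : (forall w, differentiable k w) -> k z = 0 ->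
  0 < d -> `|cre z| + d <= r -> `|cim z| + d <= r ->
  exists2 w, on_square r w & d / (6 * r) < cabs (k w - 1).
Proof.
move=> dk kz d0 zx zy; apply: contrapT => nex.
have r0 : 0 < r by have := normr_ge0 (cre z); lra.
have ck : continuous k by move=> w; apply: differentiable_continuous.
have [a [cpsi dpsi]] := @divdiff_regular k [::] z ck (fun w _ => dk w) isT.
have {}dpsi w : w != z -> differentiable (divdiff k z a) w.
  by move=> wz; apply: dpsi; rewrite in_cons negb_or wz.
have near_one w : on_square r w -> [/\ w != z,
    1 - d / (6 * r) <= cre (k w), cre (k w) <= 1 + d / (6 * r) &
    `|cim (k w)| <= d / (6 * r)].
  move=> ow.
  have small : cabs (k w - 1) <= d / (6 * r).
    by rewrite leNgt; apply/negP => h; apply: nex; exists w.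
  split.
  - apply: contraTneq ow => ->; rewrite /on_square negb_and negb_or.
    by apply/orP; right; apply/andP; split; rewrite lt_eqF //; lra.
  - by have := le_trans (cre_le_cabs _) small; rewrite creB ler_norml [cre 1]/= => /andP[]; lra.
  - by have := le_trans (cre_le_cabs _) small; rewrite creB ler_norml [cre 1]/= => /andP[]; lra.
  - by have := le_trans (cim_le_cabs _) small; rewrite cimB [cim 1]/= subr0.
have e_r : d / (6 * r) * r = d / 6 by field; rewrite gt_eqF.
have e0 : 0 < d / (6 * r) by rewrite divr_gt0 // mulr_gt0.
have e1 : d / (6 * r) <= 1 / 6.
  by rewrite ler_pdivrMr ?mulr_gt0 //; have := normr_ge0 (cre z); lra.
set e := d / (6 * r) in near_one e_r e0 e1.
(* on each side one coordinate of w - z is at least d in absolute value and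
   the other at most 2 r, so that the former decides the sign *)
have main (A B p q : R) : 1 - e <= A -> A <= 1 + e -> `|B| <= e -> d <= p -> p <= 2 * r ->
    `|q| <= 2 * r -> 0 < A * p + B * q.
  move=> A1 A2; rewrite !ler_norml => /andP[B1 B2] p1 p2 /andP[q1 q2].
  have : (1 - e) * p <= A * p by apply: ler_wpM2r => //; lra.
  have : 5 / 6 * d <= (1 - e) * p by apply: ler_pM => //; lra.
  have : - (e * (2 * r)) <= B * q.
    have : `|B * q| <= e * (2 * r) by rewrite normrM ler_pM // ler_norml; apply/andP; split.
    by rewrite ler_norml => /andP[].
  lra.
move: zx zy; rewrite -!lerBrDr !ler_norml => /andP[zx1 zx2] /andP[zy1 zy2].
have sgn (u v : R) : 0 < v -> 0 < u * v -> 0 < u by move=> v0; rewrite pmulr_lgt0.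
have rr : `|r| = r by rewrite gtr0_norm.
apply: (no_positive_flux cpsi dpsi (r := r)).
- by rewrite ltr_norml; apply/andP; split; lra.
- by rewrite ltr_norml; apply/andP; split; lra.
- move=> y yr.
  have ow : on_square r (cplx r y).
    by rewrite /on_square /in_square [cre _]/= [cim _]/= rr lexx yr eqxx.
  have [wz A1 A2 B] := near_one _ ow.
  have wz0 : cplx r y - z != 0 by rewrite subr_eq0.
  rewrite divdiffE // kz subr0; apply: sgn (normsq_gt0 wz0) _; rewrite cre_div //.
  move: yr; rewrite ler_norml => /andP[y1 y2].
  by apply: main => //; rewrite ?creB ?cimB ?ler_norml ?[cre (cplx _ _)]/= ?[cim (cplx _ _)]/=; lra.
- move=> y yr; rewrite -oppr_gt0.
  have ow : on_square r (cplx (- r) y).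
    by rewrite /on_square /in_square [cre _]/= [cim _]/= normrN rr lexx yr eqxx.
  have [wz A1 A2 B] := near_one _ ow.
  have wz0 : cplx (- r) y - z != 0 by rewrite subr_eq0.
  rewrite divdiffE // kz subr0; apply: sgn (normsq_gt0 wz0) _; rewrite mulNr cre_div //.
  rewrite opprD -!mulrN.
  move: yr; rewrite ler_norml => /andP[y1 y2].
  by apply: main => //; rewrite ?creB ?cimB ?ler_norml ?[cre (cplx _ _)]/= ?[cim (cplx _ _)]/=; lra.
- move=> x xr; rewrite -oppr_gt0.
  have ow : on_square r (cplx x r).
    by rewrite /on_square /in_square [cre _]/= [cim _]/= rr lexx xr eqxx orbT.
  have [wz A1 A2 B] := near_one _ ow.
  have wz0 : cplx x r - z != 0 by rewrite subr_eq0.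
  rewrite divdiffE // kz subr0; apply: sgn (normsq_gt0 wz0) _; rewrite mulNr cim_div //.
  rewrite opprB -mulrN.
  move: xr; rewrite ler_norml => /andP[y1 y2].
  by apply: main => //; rewrite ?creB ?cimB ?ler_norml ?[cre (cplx _ _)]/= ?[cim (cplx _ _)]/=; lra.
- move=> x xr.
  have ow : on_square r (cplx x (- r)).
    by rewrite /on_square /in_square [cre _]/= [cim _]/= normrN rr lexx xr eqxx orbT.
  have [wz A1 A2 B] := near_one _ ow.
  have wz0 : cplx x (- r) - z != 0 by rewrite subr_eq0.
  rewrite divdiffE // kz subr0; apply: sgn (normsq_gt0 wz0) _; rewrite cim_div //.
  rewrite addrC -mulrN.
  move: xr; rewrite ler_norml => /andP[y1 y2].
  by apply: main => //; rewrite ?creB ?cimB ?ler_norml ?[cre (cplx _ _)]/= ?[cim (cplx _ _)]/=; lra.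
Qed.

Lemma geometric_small (A q e : R) : 0 <= q -> q < 1 -> 0 <= A -> 0 < e ->
  exists n, A * q ^+ n <= e.
Proof.
move=> q0 q1 A0 e0.
have A1 : 0 < A + 1 by lra.
have : (GRing.exp q : nat -> R) @ \oo --> (0 : R) by apply: cvg_expr; rewrite ger0_norm.
move/cvgrPdist_lt => /(_ (e / (A + 1))); rewrite divr_gt0// => /(_ isT) [n _ Hn].
exists n; have := Hn n (leqnn n); rewrite /= sub0r normrN ger0_norm ?exprn_ge0 //.
rewrite ltr_pdivlMr // mulrDr mulr1 mulrC => h.
by have : 0 <= q ^+ n by [rewrite exprn_ge0]; lra.
Qed.

Definition node_poly S z : C := \prod_(s <- S) (z - s).

Lemma node_poly_cons s S z : node_poly (s :: S) z = (z - s) * node_poly S z.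
Proof. by rewrite /node_poly big_cons. Qed.

Lemma node_poly_neq0 S z : z \notin S -> node_poly S z != 0.
Proof.
elim: S => [|s S IH]; first by rewrite /node_poly big_nil oner_eq0.
rewrite in_cons negb_or node_poly_cons => /andP[zs zS].
by rewrite mulf_neq0 ?subr_eq0 ?IH.
Qed.

Lemma node_poly_root S z : z \in S -> node_poly S z = 0.
Proof.
elim: S => [//|s S IH]; rewrite in_cons node_poly_cons => /orP[/eqP->|/IH->].
  by rewrite subrr mul0r.
by rewrite mulr0.
Qed.

Lemma cabs_node_poly_le S z (a : R) : cabs z <= a ->
  cabs (node_poly S z) <= \prod_(s <- S) (a + cabs s).
Proof.
move=> za; elim: S => [|s S IH].
  by rewrite /node_poly !big_nil -le_ofR -cabsE normr1.
rewrite node_poly_cons big_cons cabsM ler_pM ?cabs_ge0 //.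
by apply: le_trans (cabsB _ _) _; rewrite lerD2r.
Qed.

Lemma differentiable_subr s w : differentiable (fun w : C => w - s) w.
Proof.
exact: (@differentiableB C C C id (cst s) w (ex_diff (df := id)) (differentiable_cst _ _)).
Qed.

Lemma differentiable_node_poly S w : differentiable (node_poly S) w.
Proof.
elim: S => [|s S IH].
  have -> : node_poly [::] = cst 1.
    by apply: funext => z; rewrite /node_poly big_nil.
  exact: differentiable_cst.
have -> : node_poly (s :: S) = (fun w : C => w - s) * node_poly S.
  by apply: funext => z; rewrite node_poly_cons.
by apply: differentiableM IH; apply: differentiable_subr.
Qed.

(** The difference quotient of p h at a zero s of p is that of p multiplied by
    a value of h near s, so that continuity of h suffices. *)
Lemma differentiable_mul_vanish (h p : C -> C) s : {for s, continuous h} ->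
  differentiable p s -> p s = 0 -> differentiable (p * h) s.
Proof.
move=> ch /derivable1_diffP dp p0; apply/derivable1_diffP.
have e0 : (p * h) s = 0 by rewrite -[LHS]/(p s * h s) p0 mul0r.
have ht : h (t *: 1 + s) @[t --> 0^'] --> h s.
  apply/cvgrPdist_le => e ep; apply: cvg_within.
  have /(@cvgrPdist_le C C _ (nbhs s) (nbhs_filter s))/(_ e ep) := ch.
  move=> /nbhs_ballP [d d0 Hd]; apply/nbhs_ballP; exists d => // t.
  rewrite /ball /= sub0r normrN => td; apply: Hd.
  rewrite /ball /= [t *: 1](_ : _ = t * 1) // mulr1 opprD addrCA subrr addr0.
  by rewrite normrN.
apply: (cvgP ('D_1 p s * h s)).
have -> : (fun t : C => t^-1 *: ((p * h \o shift s) (t *: 1) - (p * h) s)) =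
   (fun t : C => t^-1 *: ((p \o shift s) (t *: 1) - p s)) * (fun t => h (t *: 1 + s)).
  apply: funext => t.
  rewrite -[RHS]/(t^-1 * (p (t *: 1 + s) - p s) * h (t *: 1 + s)).
  rewrite -[LHS]/(t^-1 * (p (t *: 1 + s) * h (t *: 1 + s) - (p * h) s)).
  by rewrite e0 p0 !subr0 mulrA.
exact: (cvgM dp ht).
Qed.

Lemma differentiable_node_poly_mul S h m w : continuous h ->
  (forall w, w \notin S -> differentiable h w) ->
  differentiable (node_poly S * h ^+ m) w.
Proof.
move=> ch dh; have [wS|wS] := boolP (w \in S).
  apply: differentiable_mul_vanish.
  - elim: m => [|m IH]; first exact: cst_continuous.
    rewrite exprS; apply: (@continuousM C C h (h ^+ m)); [exact: ch|exact: IH].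
  - exact: differentiable_node_poly.
  - exact: node_poly_root.
apply: differentiableM; first exact: differentiable_node_poly.
elim: m => [|m IH]; first exact: differentiable_cst.
by rewrite exprS; apply: differentiableM IH; apply: dh.
Qed.

(** A strict violation at z is amplified by taking powers: (h / h z) ^ m is
    small on the boundary and 1 at z.  Multiplying it by [node_poly S] makes it
    differentiable on S as well, at the price of a factor that is independent
    of m. *)
Lemma max_principle h S r (M : R) z : continuous h ->
  (forall w, w \notin S -> differentiable h w) ->
  (forall w, on_square r w -> cabs (h w) <= M) ->
  z \notin S -> in_square r z -> cabs (h z) <= M.
Proof.
move=> ch dh bd zS /andP[zx zy].
have [oz|] := boolP (on_square r z); first exact: bd.
rewrite /on_square /in_square zx zy /= negb_or => /andP[nx ny].
have {}zx : `|cre z| < r by rewrite lt_neqAle nx.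
have {}zy : `|cim z| < r by rewrite lt_neqAle ny.
have r0 : 0 < r by apply: le_lt_trans zx.
pose d := Num.min (r - `|cre z|) (r - `|cim z|).
have d0 : 0 < d by rewrite lt_min !subr_gt0 zx.
have dx : `|cre z| + d <= r by rewrite -lerBrDl /d ge_min lexx.
have dy : `|cim z| + d <= r by rewrite -lerBrDl /d ge_min lexx orbT.
have M0 : 0 <= M.
  apply: le_trans (cabs_ge0 _) (bd (cplx r 0) _).
  by rewrite /on_square /in_square [cre _]/= [cim _]/= normr0 gtr0_norm // lexx ltW //= eqxx.
rewrite leNgt; apply/negP => hzM.
have hz0 : h z != 0 by rewrite -cabs_gt0; apply: le_lt_trans hzM.
pose P := node_poly S z.
have P0 : P != 0 by apply: node_poly_neq0.
pose B := \prod_(s <- S) (2 * r + cabs s).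
have B0 : 0 <= B by apply: prodr_ge0 => s _; rewrite addr_ge0 ?cabs_ge0 // mulr_ge0 // ltW.
have q1 : M / cabs (h z) < 1 by rewrite ltr_pdivrMr ?mul1r // cabs_gt0.
have q0 : 0 <= M / cabs (h z) by rewrite divr_ge0 ?cabs_ge0.
have A0 : 0 <= B / cabs P by rewrite divr_ge0 ?cabs_ge0.
have e0 : 0 < d / (6 * r) by rewrite divr_gt0 // mulr_gt0.
have [m Hm] := geometric_small q0 q1 A0 e0.
pose c := P * h z ^+ m.
have c0 : c != 0 by rewrite mulf_neq0 // expf_neq0.
pose k := cst 1 - c^-1 *: (node_poly S * h ^+ m).
have kE w : k w = 1 - c^-1 * (node_poly S w * h w ^+ m).
  rewrite -[LHS]/(1 - c^-1 * (node_poly S w * (h ^+ m) w)).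
  congr (_ - _ * (_ * _)); elim: m {Hm c c0 k} => [//|m IH].
  by rewrite !exprS -IH.
have dk w : differentiable k w.
  apply: differentiableB; first exact: differentiable_cst.
  by apply: differentiableZ; apply: differentiable_node_poly_mul.
have kz : k z = 0 by rewrite kE -/P -/c mulVf // subrr.
have [w ow] := zero_not_nearly_one dk kz d0 dx dy.
rewrite ltNge => /negP; apply; apply: le_trans Hm.
rewrite kE addrAC subrr add0r cabsN.
have cV : cabs c^-1 = (cabs c)^-1.
  by apply: (@complexI R); rewrite fmorphV -[LHS]/(ofR (cabs c^-1)) -cabsE normfV cabsE.
rewrite cabsM cV cabsM cabsX /c cabsM cabsX invfM expr_div_n.
have -> : (cabs P)^-1 * (cabs (h z) ^+ m)^-1 * (cabs (node_poly S w) * cabs (h w) ^+ m) =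
   (cabs (node_poly S w) / cabs P) * (cabs (h w) ^+ m / cabs (h z) ^+ m) by ring.
have Pg : 0 < cabs P by rewrite cabs_gt0.
have hg : 0 < cabs (h z) ^+ m by rewrite exprn_gt0 // cabs_gt0.
apply: ler_pM; rewrite ?divr_ge0 ?exprn_ge0 ?cabs_ge0 //.
  rewrite ler_pM2r ?invr_gt0 //; apply: cabs_node_poly_le.
  by apply: in_square_cabs; case/andP: ow.
by rewrite ler_pM2r ?invr_gt0 // lerXn2r ?nnegrE ?cabs_ge0 // bd.
Qed.

End MaxPrinciple.

(** * Newton interpolation at fixed nodes *)

Section Interpolation.
Variable R : realType.
Local Notation C := (Cplx R).
Implicit Types (z w : C) (h D : C -> C) (S : seq C) (r x y M : R).

Definition node (k : nat) : C := ofR (k.+1%:R^-1 : R).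

Definition nodes (a N : nat) : seq C := [seq node i | i <- iota a N].

Lemma cabs_node k : cabs (node k) <= 1.
Proof. by rewrite cabs_ofR ?invr_ge0 ?ler0n // invf_le1 ?ltr0n // ler1n. Qed.

Lemma node_inj : injective node.
Proof.
move=> i j /(congr1 (@cre R)) /= /invr_inj /eqP; rewrite eqr_nat => /eqP [] //.
Qed.

Lemma on_square_cabs r w : on_square r w -> r <= cabs w.
Proof.
by move=> /andP[_ /orP[/eqP <-|/eqP <-]]; [apply: cre_le_cabs|apply: cim_le_cabs].
Qed.

(** Newton's form of the interpolation error: the L j are the Lagrange basis
    polynomials of the nodes with index at least a, and D is the divided
    difference of h at these nodes.  The maximum principle bounds h at the first
    node by its values on the boundary of the square, so that each division
    costs a factor 2 / (r - 1).  The basis does not depend on h. *)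
Lemma newton_remainder N a : exists L : nat -> {poly C},
  forall h S r M, continuous h -> (forall w, w \notin S -> differentiable h w) ->
  (forall b, (a <= b)%N -> node b \notin S) -> 1 < r ->
  (forall w, on_square r w -> cabs (h w) <= M) ->
  exists D, [/\ continuous D,
    forall w, w \notin S -> w \notin nodes a N -> differentiable D w,
    forall w, on_square r w -> cabs (D w) <= M * (2 / (r - 1)) ^+ N &
    forall z, h z - \sum_(j < N) h (node (a + j)) * (L j).[z] =
              D z * node_poly (nodes a N) z].
Proof.
elim: N a => [|N IH] a.
  exists (fun _ => 0) => h S r M ch dh _ _ bd; exists h; split; first exact: ch.
  - by move=> w wS _; apply: dh.
  - by move=> w ow; rewrite expr0 mulr1 bd.
  - by move=> z; rewrite big_ord0 subr0 /node_poly big_nil mulr1.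
have [L HL] := IH a.+1.
pose c j := (node (a.+1 + j) - node a)^-1.
pose F j : {poly C} := (c j)%:P * ('X - (node a)%:P) * L j.
exists (fun j => if j is j'.+1 then F j' else 1 - \sum_(j < N) F j).
move=> h S r M ch dh nS r1 bd.
have nSa : node a \notin S by apply: nS.
have [al [cd dd]] := divdiff_regular ch dh nSa.
set h1 := divdiff h (node a) al in cd dd.
have nodeS b : (a.+1 <= b)%N -> node b \notin node a :: S.
  move=> ab; rewrite in_cons negb_or (nS _ (ltnW ab)) andbT.
  by rewrite (inj_eq node_inj) gtn_eqF.
have bd1 w : on_square r w -> cabs (h1 w) <= M * (2 / (r - 1)).
  move=> ow; have wr := on_square_cabs ow.
  have wa : w != node a.
    by apply: contraTneq wr => ->; rewrite -ltNge; apply: le_lt_trans (cabs_node a) r1.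
  have ha : cabs (h (node a)) <= M.
    apply: (max_principle ch dh bd nSa).
    have := cabs_node a; rewrite /in_square => n1.
    by rewrite !(le_trans (cre_le_cabs _)) ?(le_trans (cim_le_cabs _)) ?(le_trans n1) ?ltW.
  have hw := bd w ow.
  rewrite /h1 divdiffE // cabs_div ler_pdivrMr; last by rewrite cabs_gt0 subr_eq0.
  have M0 : 0 <= M by apply: le_trans ha; apply: cabs_ge0.
  have wn : r - 1 <= cabs (w - node a).
    have := cabsD (w - node a) (node a); rewrite subrK; have := cabs_node a; lra.
  apply: le_trans (cabsB _ _) _.
  apply: (@le_trans _ _ (M * (2 / (r - 1)) * (r - 1))).
    by rewrite -mulrA divfK ?subr_eq0 ?gt_eqF //; lra.
  by rewrite ler_wpM2l // mulr_ge0 // divr_ge0 //; lra.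
have [D [cD dD bD eD]] := HL h1 (node a :: S) r _ cd dd nodeS r1 bd1.
exists D; split; first exact: cD.
- move=> w wS; rewrite /nodes /= in_cons negb_or => /andP[wa wN]; apply: dD; last exact: wN.
  by rewrite in_cons negb_or wa.
- by move=> w ow; rewrite exprS mulrA; apply: bD.
move=> z.
have hz : h z = h (node a) + (z - node a) * h1 z.
  rewrite /h1 /divdiff; case: eqVneq => [->|za]; first by rewrite subrr mul0r addr0.
  by rewrite mulrCA divff ?subr_eq0 // mulr1 addrC subrK.
rewrite [nodes a N.+1](_ : _ = node a :: nodes a.+1 N) // node_poly_cons.
rewrite mulrCA -eD big_ord_recl /= addn0 hornerD hornerN hornerC horner_sum.
have h1n (j : 'I_N) : h1 (node (a.+1 + j)) = c j * (h (node (a.+1 + j)) - h (node a)).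
  rewrite /h1 divdiffE; first by rewrite mulrC.
  by rewrite (inj_eq node_inj) gtn_eqF // ltn_addr.
have FE (j : nat) : (F j).[z] = c j * (z - node a) * (L j).[z].
  by rewrite !hornerE.
rewrite hz [RHS]mulrBr [in RHS]mulr_sumr.
have -> : \sum_(i < N) (z - node a) * (h1 (node (a.+1 + i)) * (L i).[z]) =
   \sum_(i < N) h (node (a.+1 + i)) * (F i).[z] - h (node a) * \sum_(i < N) (F i).[z].
  rewrite mulr_sumr -sumrB; apply: eq_bigr => i _; rewrite h1n FE; ring.
under [in LHS]eq_bigr => i _ do rewrite /bump /= add1n addnS -addSn add0n.
rewrite mulrBr mulr1; ring.
Qed.

(** On the small square the node polynomial is at most (2 r + 1) ^ N, on the large
    one the divided difference is at most M (2 / (8 r + 4)) ^ N: the size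
    8 r + 5 is chosen to make the product M / 2 ^ N. *)
Lemma polynomial_interpolation N : exists L : nat -> {poly C},
  forall h r M, (forall w, differentiable h w) -> 0 <= r ->
  (forall w, in_square (8 * r + 5) w -> cabs (h w) <= M) ->
  forall z, in_square r z ->
    cabs (h z - \sum_(j < N) h (node j) * (L j).[z]) <= M * 2^-1 ^+ N.
Proof.
have [L HL] := newton_remainder N 0.
exists L => h r M dh r0 bd z zr.
have ch : continuous h by move=> w; apply: differentiable_continuous.
have R1 : 1 < 8 * r + 5 by lra.
have bd' w : on_square (8 * r + 5) w -> cabs (h w) <= M by case/andP => /bd.
have [D [cD dD bD eD]] := HL h [::] _ _ ch (fun w _ => dh w) (fun _ _ => isT) R1 bd'.
have := eD z; under eq_bigr do rewrite add0n; move=> ->.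
have M0 : 0 <= M.
  apply: le_trans (cabs_ge0 (h 0)) (bd _ _); rewrite /in_square [cre _]/= [cim _]/=.
  by rewrite normr0 andbb; lra.
have MN : 0 <= M * 2^-1 ^+ N by rewrite mulr_ge0 // exprn_ge0 // invr_ge0.
have [zn|zn] := boolP (z \in nodes 0 N).
  rewrite node_poly_root // mulr0 (_ : cabs 0 = 0) //.
  by apply/eqP; rewrite cabs_eq0.
have zR : in_square (8 * r + 5) z.
  by move: zr => /andP[z1 z2]; apply/andP; split; lra.
have Dz := max_principle cD (fun w => dD w isT) bD zn zR.
rewrite cabsM; apply: (@le_trans _ _ ((M * (2 / (8 * r + 5 - 1)) ^+ N) * (2 * r + 1) ^+ N)).
  apply: ler_pM; rewrite ?cabs_ge0 //.
  apply: le_trans (cabs_node_poly_le _ (in_square_cabs zr)) _.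
  rewrite /nodes big_map.
  have -> : (2 * r + 1) ^+ N = \prod_(i <- iota 0 N) (2 * r + 1).
    by rewrite big_const_seq count_predT size_iota iter_mulr_1.
  apply: ler_prod => i _; rewrite addr_ge0 ?cabs_ge0 ?mulr_ge0 //=.
  by rewrite lerD2l cabs_node.
rewrite -mulrA -exprMn le_eqVlt; apply/orP; left; apply/eqP; congr (_ * _ ^+ _).
by field; rewrite gt_eqF //; lra.
Qed.

End Interpolation.

(** * Polynomials in several variables and their zeros *)

(** This separates monomials after the substitution z_i = t ^ (B ^ i). *)
Lemma digits_inj (B n : nat) (f g : nat -> nat) :
  (forall i, (i < n)%N -> (f i < B)%N) -> (forall i, (i < n)%N -> (g i < B)%N) ->
  (\sum_(i < n) f i * B ^ i = \sum_(i < n) g i * B ^ i)%N ->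
  forall i, (i < n)%N -> f i = g i.
Proof.
elim: n f g => [//|n IH] f g hf hg.
have B0 : (0 < B)%N by apply: leq_ltn_trans (hf 0 isT).
rewrite !big_ord_recl /= !expn0 !muln1.
have shift (h : nat -> nat) : (\sum_(i < n) h (bump 0 i) * B ^ bump 0 i =
    (\sum_(i < n) h i.+1 * B ^ i) * B)%N.
  by rewrite big_distrl /=; apply: eq_bigr => i _; rewrite /bump add1n expnSr mulnA.
rewrite !shift => E.
have E0 : f 0 = g 0.
  have := congr1 (modn^~ B) E.
  by rewrite /= ![(_ + _ * B)%N]addnC !modnMDl !modn_small ?hf ?hg.
move: E; rewrite E0 => /addnI /eqP; rewrite eqn_mul2r eqn0Ngt B0 /= => /eqP E.
have IH' := IH (fun i => f i.+1) (fun i => g i.+1) (fun i => hf i.+1) (fun i => hg i.+1) E.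
by case=> [//|i] hi; apply: IH'.
Qed.

Section Polynomials.
Variables (R : realType) (n : nat).
Local Notation C := (Cplx R).
Local Notation poly_n := (mpoly n C).
Implicit Types (z x : 'cV[C]_n) (p q : poly_n).

Definition coordX (i : 'I_n) : poly_n := mpolyX C (mnm1 i).
Definition constP (c : C) : poly_n := mpolyC n c.

Lemma polyfunD p q z : polyfun (p + q) z = polyfun p z + polyfun q z.
Proof. exact: mevalD. Qed.
Lemma polyfunB p q z : polyfun (p - q) z = polyfun p z - polyfun q z.
Proof. exact: mevalB. Qed.
Lemma polyfunM p q z : polyfun (p * q) z = polyfun p z * polyfun q z.
Proof. exact: mevalM. Qed.
Lemma polyfunC c z : polyfun (constP c) z = c.
Proof. exact: mevalC. Qed.
Lemma polyfunX i z : polyfun (coordX i) z = z i ord0.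
Proof. exact: mevalXU. Qed.
Lemma polyfun_sum (I : Type) (s : seq I) (P : pred I) (f : I -> poly_n) z :
  polyfun (\sum_(i <- s | P i) f i) z = \sum_(i <- s | P i) polyfun (f i) z.
Proof. exact: (raddf_sum (meval (fun j => z j ord0))). Qed.

Definition univariate (u : {poly C}) (i : 'I_n) : poly_n :=
  (map_poly constP u).[coordX i].

Lemma polyfun_univariate u i z : polyfun (univariate u i) z = u.[z i ord0].
Proof.
rewrite /univariate -[LHS]/(meval (fun j => z j ord0) _).
rewrite -(horner_map (meval (fun j => z j ord0))) /=.
rewrite -map_poly_comp /= (_ : meval _ (coordX i) = z i ord0); last exact: mevalXU.
congr (_.[_]); rewrite -[RHS](@map_poly_id _ (fun c => c)) //.
by apply: eq_map_poly => c; rewrite /= mevalC.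
Qed.

Lemma mpoly_ring_ind (P : poly_n -> Prop) : (forall c, P (constP c)) ->
  (forall i, P (coordX i)) -> (forall p q, P p -> P q -> P (p + q)) ->
  (forall p q, P p -> P q -> P (p * q)) -> forall p, P p.
Proof.
move=> PC PX PD PM p; rewrite (mpolyE p).
have P1 : P 1 by have := PC 1; rewrite /constP mpolyC1.
elim/big_rec: _ => [|m q _ Pq]; first by have := PC 0; rewrite /constP mpolyC0.
apply: PD Pq; rewrite -mul_mpolyC; apply: (PM); first exact: PC.
rewrite mpolyXE_id; elim/big_rec: _ => [//|i q' _ Pq']; apply: (PM _ _ _ Pq').
elim: (m i) => [//|k IH]; rewrite exprS; exact: (PM _ _ (PX i) IH).
Qed.

Lemma poly_eval_eq0 (u : {poly C}) : (forall t, u.[t] = 0) -> u = 0.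
Proof.
move=> u0; apply/eqP; apply: contraT => nz.
have := max_poly_roots (rs := [seq i%:R | i <- iota 0 (size u)]) nz.
rewrite size_map size_iota ltnn => -> //.
  by apply/allP => t _; rewrite /root u0.
rewrite map_inj_uniq ?iota_uniq // => i j /eqP.
by rewrite eqr_nat => /eqP.
Qed.

(** Kronecker's substitution z_i = t ^ (B ^ i), with B above all exponents, sends
    distinct monomials to distinct powers of t, and a polynomial in one variable
    that vanishes everywhere is 0. *)
Lemma polyfun_eq0 p : (forall z, polyfun p z = 0) -> p = 0.
Proof.
move=> p0; pose B := msize p.
pose code (m : multinom n) := (\sum_(i < n) m i * B ^ i)%N.
pose u : {poly C} := \sum_(m <- msupp p) mcoeff m p *: 'X^(code m).
have u0 : u = 0.
  apply: poly_eval_eq0 => t.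
  rewrite -[RHS](p0 (\col_i t ^+ (B ^ i))) /polyfun mevalE horner_sum.
  apply: eq_bigr => m _; rewrite hornerZ hornerXn; congr (_ * _).
  rewrite /code -prodrXr; apply: eq_bigr => i _.
  by rewrite mxE -exprM mulnC.
apply/eqP; rewrite -msupp_eq0; case E : (msupp p) => [//|m s].
have mp : m \in msupp p by rewrite E mem_head.
have : u`_(code m) = 0 by rewrite u0 coef0.
rewrite /u coef_sum (bigD1_seq m) ?msupp_uniq //= big1_seq => [|m' /andP[ne mp']].
  rewrite addr0 coefZ coefXn eqxx mulr1 => /eqP; by rewrite mcoeff_eq0 mp.
rewrite coefZ coefXn; case: eqP => [eqc|_]; last by rewrite mulr0.
case/negP: ne; apply/eqP/mnmP => i.
have deg m'' : m'' \in msupp p -> forall k : 'I_n, (m'' k < B)%N.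
  move=> /msize_mdeg_lt; rewrite mdegE => h k; apply: leq_ltn_trans h.
  by rewrite (bigD1 k) //= leq_addr.
pose ext (m'' : multinom n) (k : nat) := if insub k is Some k' then m'' k' else 0%N.
have extE m'' (k : 'I_n) : ext m'' k = m'' k by rewrite /ext valK.
have := @digits_inj B n (ext m') (ext m).
rewrite -!extE; apply => //.
- by move=> k kn; rewrite -[k]/(val (Ordinal kn)) extE deg.
- by move=> k kn; rewrite -[k]/(val (Ordinal kn)) extE deg.
- rewrite [LHS](_ : _ = code m'); last by apply: eq_bigr => k _; rewrite extE.
  by rewrite -eqc; apply: eq_bigr => k _; rewrite extE.
Qed.

(** When u splits into factors X_i - a, one of them can be adjoined to the ideal
    without making it improper: otherwise the factors of a product in the ideal
    would be invertible modulo it.  Adjoining one factor for each variable gives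
    a proper ideal that contains all X_i - x_i, hence all p - p (x). *)
Lemma zero_of_proper_ideal (I : set poly_n) :
  (forall p q, I p -> I q -> I (p + q)) -> (forall p q, I q -> I (p * q)) -> ~ I 1 ->
  (forall i, exists2 u : {poly C}, u != 0 & I (univariate u i)) ->
  exists x, forall p, I p -> polyfun p x = 0.
Proof.
move=> ID IM I1 Iu.
have step (s : seq 'I_n) : exists (J : set poly_n) (x : 'cV[C]_n),
    [/\ forall p, I p -> J p,
        forall p q, J p -> J q -> J (p + q), forall p q, J q -> J (p * q), ~ J 1 &
        forall i, i \in s -> J (coordX i - constP (x i ord0))].
  elim: s => [|i s [J [x [IJ JD JM J1 Jx]]]]; first by exists I, 0.
  pose ext (a : C) : set poly_n :=
    [set p | exists q r, J q /\ p = q + r * (coordX i - constP a)].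
  have [a Ja] : exists a, ~ ext a 1.
    have [u u0 /IJ] := Iu i.
    have [rs ->] := closed_field_poly_normal u.
    rewrite /univariate => Ju.
    have : J (\prod_(a <- rs) (coordX i - constP a)).
      have lc : lead_coef u != 0 by rewrite lead_coef_eq0.
      have := JM (constP (lead_coef u)^-1) _ Ju.
      rewrite linearZ /= hornerZ mulrA /constP -mpolyCM mulVf // mpolyC1 mul1r.
      rewrite rmorph_prod horner_prod; congr J; apply: eq_bigr => a _.
      by rewrite rmorphB /= map_polyX map_polyC hornerD hornerN hornerX hornerC.
    elim: rs {Ju} => [|a rs IH]; first by rewrite big_nil.
    rewrite big_cons => Ja; have [[q [r [Jq e1]]]|] := pselect (ext a 1); last by exists a.
    apply: IH; set w := \prod_(_ <- rs) _ in Ja *.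
    have -> : w = w * q + r * ((coordX i - constP a) * w).
      by rewrite -[LHS]mul1r {1}e1; ring.
    by apply: JD; apply: JM.
  have Jext p : J p -> ext a p by move=> Jp; exists p, 0; rewrite mul0r addr0.
  exists (ext a), (\col_j if j == i then a else x j ord0); split.
  - by move=> p /IJ /Jext.
  - move=> _ _ [q1 [r1 [J1q ->]]] [q2 [r2 [J2q ->]]].
    exists (q1 + q2), (r1 + r2); split; first exact: JD.
    by rewrite mulrDl addrACA.
  - move=> p _ [q [r [Jq ->]]]; exists (p * q), (p * r); split; first exact: JM.
    by rewrite mulrDr mulrA.
  - exact: Ja.
  - move=> j; rewrite in_cons mxE; case: eqVneq => [-> _|_ /= js]; last exact/Jext/Jx.
    exists 0, 1; split; last by rewrite add0r mul1r.
    have [u _ Iui] := Iu i.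
    by rewrite -(mul0r (univariate u i)); apply: JM; apply: IJ.
have [J [x [IJ JD JM J1 Jx]]] := step (enum 'I_n).
exists x => p Ip.
have J0 : J 0 by rewrite -(mul0r p); apply: JM; apply: IJ.
have Jp q : J (q - constP (polyfun q x)).
  elim/mpoly_ring_ind: q => [c|i|q1 q2 h1 h2|q1 q2 h1 h2].
  - by rewrite polyfunC subrr.
  - by rewrite polyfunX; apply: Jx; rewrite mem_enum.
  - rewrite polyfunD /constP mpolyCD opprD addrACA; exact: JD.
  - rewrite polyfunM /constP mpolyCM -/(constP _).
    have -> : q1 * q2 - constP (polyfun q1 x) * constP (polyfun q2 x) =
      q1 * (q2 - constP (polyfun q2 x)) + constP (polyfun q2 x) * (q1 - constP (polyfun q1 x)) by ring.
    by apply: JD; apply: JM.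
apply/eqP; apply: contra_notT J1 => nz.
have := JM (constP (polyfun p x)^-1) _ (JD _ _ (IJ _ Ip) (JM (-1) _ (Jp p))).
by rewrite mulN1r opprB addrC subrK /constP -mpolyCM mulVf // mpolyC1.
Qed.

Lemma continuous_polyfun p : continuous (polyfun p).
Proof.
move=> z; elim/mpoly_ring_ind: p => [c|i|p q hp hq|p q hp hq].
- have -> : polyfun (constP c) = cst c by apply: funext => w; apply: polyfunC.
  exact: cst_continuous.
- have -> : polyfun (coordX i) = (fun w => w i ord0).
    by apply: funext => w; apply: polyfunX.
  exact: coord_continuous.
- have -> : polyfun (p + q) = polyfun p + polyfun q.
    by apply: funext => w; apply: polyfunD.
  exact: (@continuousD C C _ (polyfun p) (polyfun q) z hp hq).
- have -> : polyfun (p * q) = polyfun p \* polyfun q.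
    by apply: funext => w; apply: polyfunM.
  exact: (@continuousM C _ (polyfun p) (polyfun q) z hp hq).
Qed.

End Polynomials.

(** * Polynomial approximation of entire functions *)

Section Approximation.
Variables (R : realType) (n : nat).
Local Notation C := (Cplx R).
Local Notation poly_n := (mpoly n C).
Implicit Types (F : 'cV[C]_n -> C) (z : 'cV[C]_n) (p q : poly_n) (r M e : R).

Definition in_box r z := forall i, in_square r (z i ord0).

(** The real and imaginary parts of the coordinates range over a compact cube of
    real dimension 2 n. *)
Lemma bounded_on_box F r : continuous F -> exists M, forall z, in_box r z -> cabs (F z) <= M.
Proof.
move=> cF.
have [[z0 z0r]|nz] := pselect (exists z, in_box r z); last first.
  by exists 0 => z zr; case: nz; exists z.
pose G (v : 'rV[R]_(n + n)) : 'cV[C]_n :=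
  \col_i cplx (v ord0 (lshift n i)) (v ord0 (rshift n i)).
pose A (i : 'I_(n + n)) : set R := [set` `[- r, r]].
have cA : compact [set v : 'rV[R]_(n + n) | forall i, A i (v ord0 i)].
  by apply: rV_compact => i; apply: segment_compact.
have cG : continuous (fun v => cabs (F (G v))).
  move=> v; apply/(@cvgrPdist_le R R _ (nbhs v) (nbhs_filter v)) => e e0.
  have /(@cvgrPdist_le C C _ (nbhs (G v)) (nbhs_filter (G v)))/(_ _ (ofR_gt0 e0)) := cF (G v).
  move=> /nbhs_ballP [d d0 Hd]; have [dE d0'] := gt0_ofR d0.
  apply/nbhs_ballP; exists (cre d / 2); first by rewrite /=; lra.
  move=> u [_ uv].
  have : cabs (F (G v) - F (G u)) <= e.
    rewrite -le_ofR -cabsE; apply: Hd; split => // i j.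
    have := uv ord0 (lshift n i); have := uv ord0 (rshift n i).
    rewrite /ball /= dE cabsE lt_ofR !mxE => h1 h2.
    apply: le_lt_trans (cabs_le_parts _) _.
    by rewrite creB cimB [cre _]/= [cim _]/= [cre _]/= [cim _]/=; lra.
  have h1 := cabsD (F (G v) - F (G u)) (F (G u)).
  have h2 := cabsD (F (G u) - F (G v)) (F (G v)).
  move: h1 h2; rewrite !subrK -[cabs (F (G u) - F (G v))]cabsN opprB => h1 h2 h3.
  by rewrite ler_norml; apply/andP; split; lra.
pose V z : 'rV[R]_(n + n) := \row_i match fintype.split i with
  | inl j => cre (z j ord0) | inr j => cim (z j ord0) end.
have AV z : in_box r z -> forall i, A i (V z ord0 i).
  move=> zr i; rewrite mxE /A /= in_itv /=.
  by case: (fintype.split i) => j; have /andP[] := zr j; rewrite !ler_norml.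
have A0 : [set v : 'rV[R]_(n + n) | forall i, A i (v ord0 i)] !=set0.
  by exists (V z0); apply: AV.
have [v _ Hv] := compact_EVT_max A0 cA (continuous_subspaceT cG).
exists (cabs (F (G v))) => z zr.
have -> : z = G (V z).
  by apply/colP => i; rewrite !mxE !(unsplitK (inl i)) !(unsplitK (inr i)) -cplxE.
by apply: Hv; rewrite inE; apply: AV.
Qed.

Definition update (k : 'I_n) (w : C) z : 'cV[C]_n := z + (w - z k ord0) *: delta_mx k ord0.

Lemma updateE k w z i : update k w z i ord0 = if i == k then w else z i ord0.
Proof.
rewrite !mxE eqxx andbT; case: eqVneq => [->|_]; last by rewrite mulr0 addr0.
by rewrite mulr1 addrC subrK.
Qed.

Lemma holomorphic_update F k w : holomorphic F -> holomorphic (fun z => F (update k w z)).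
Proof.
move=> hF z; apply: (@differentiable_comp C _ _ _ (update k w) F); last exact: hF.
apply: (@differentiableD C _ _ id (fun z => (w - z k ord0) *: delta_mx k ord0)).
  exact: (ex_diff (df := id)).
apply: differentiableZl; apply: differentiableB; first exact: differentiable_cst.
exact: differentiable_coord.
Qed.

Lemma differentiable_slice F k z w : holomorphic F ->
  differentiable (fun t : C => F (update k t z)) w.
Proof.
move=> hF; apply: (@differentiable_comp C _ _ _ (fun t => update k t z) F); last exact: hF.
apply: (@differentiableD C _ _ (cst z) (fun t => (t - z k ord0) *: delta_mx k ord0)).
  exact: differentiable_cst.
by apply: differentiableZl; apply: differentiable_subr.
Qed.

Lemma in_box_update r k w z : in_box r z -> in_square r w -> in_box r (update k w z).
Proof. by move=> zr wr i; rewrite updateE; case: ifP. Qed.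

Lemma in_box_le r s z : r <= s -> in_box r z -> in_box s z.
Proof. by move=> rs zr i; have /andP[h1 h2] := zr i; apply/andP; split; lra. Qed.

Lemma bounded_horner (u : {poly C}) r : exists2 B, 0 <= B &
  forall w, in_square r w -> cabs u.[w] <= B.
Proof.
exists (\sum_(i < size u) cabs u`_i * `|2 * r| ^+ i).
  by apply: sumr_ge0 => i _; rewrite mulr_ge0 ?cabs_ge0 ?exprn_ge0.
move=> w wr; rewrite horner_coef; apply: le_trans (cabs_sum _) _.
apply: ler_sum => i _; rewrite cabsM cabsX ler_wpM2l ?cabs_ge0 //.
apply: lerXn2r; rewrite ?nnegrE ?cabs_ge0 //.
by apply: le_trans (in_square_cabs wr) (ler_norm _).
Qed.

(** Induction on the number k of variables on which F depends.  Interpolation in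
    the last one replaces F by a combination of functions F (update k0 w _), with
    w a node, that are again entire and depend on one variable less.  Their
    coefficients are polynomials and bounded on the box, which tells how well
    these functions have to be approximated. *)
Lemma polynomial_approximation_partial (k : nat) : (k <= n)%N -> forall F, holomorphic F ->
  (forall z z', (forall i : 'I_n, (i < k)%N -> z i ord0 = z' i ord0) -> F z = F z') ->
  forall r e, 0 <= r -> 0 < e ->
  exists p, forall z, in_box r z -> cabs (F z - polyfun p z) <= e.
Proof.
elim: k => [|k IH] kn F hF dep r e r0 e0.
  exists (constP n (F 0)) => z _; rewrite polyfunC (dep z 0) //.
  by rewrite subrr (_ : cabs 0 = 0) ?ltW //; apply/eqP; rewrite cabs_eq0.
pose k0 : 'I_n := Ordinal kn.
have cF : continuous F by move=> z; apply: differentiable_continuous (hF z).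
have [M HM] := bounded_on_box (8 * r + 5) cF.
have M0 : 0 <= M.
  apply: le_trans (cabs_ge0 (F 0)) (HM _ _) => i; rewrite mxE /in_square [cre _]/= [cim _]/=.
  by rewrite normr0 andbb; lra.
have q0 : 0 <= 2^-1 :> R by lra.
have q1 : 2^-1 < 1 :> R by lra.
have e2 : 0 < e / 2 by lra.
have [N HN] := geometric_small q0 q1 M0 e2.
have [L HL] := polynomial_interpolation R N.
have hL j : exists B, 0 <= B /\ forall w, in_square r w -> cabs (L j).[w] <= B.
  by have [b b0 hb] := bounded_horner (L j) r; exists b.
have {hL} [B HB] := boolp.choice hL.
pose ee j := e / 2 / N.+1%:R / (B j + 1).
have ee0 j : 0 < ee j.
  by have [b0 _] := HB j; rewrite /ee !divr_gt0 // ltr_wpDl.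
have hp j : exists p, forall z, in_box r z ->
    cabs (F (update k0 (node R j) z) - polyfun p z) <= ee j.
  apply: (IH (ltnW kn) _ (holomorphic_update k0 (node R j) hF) _ r (ee j) r0 (ee0 j)).
  move=> z z' zz'; apply: dep => i ik; rewrite !updateE.
  case: (eqVneq i k0) => // ik0; apply: zz'.
  by rewrite ltn_neqAle -ltnS ik andbT.
have {hp} [p Hp] := boolp.choice hp.
exists (\sum_(j < N) p j * univariate (L j) k0) => z zr.
pose t := z k0 ord0.
have zt : F z = F (update k0 t z) by congr F; rewrite /update /t subrr scale0r addr0.
have h1 : cabs (F z - \sum_(j < N) F (update k0 (node R j) z) * (L j).[t]) <= e / 2.
  apply: le_trans HN; rewrite zt.
  apply: (HL (fun w => F (update k0 w z)) r M _ r0 _ t (zr k0)).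
    by move=> w; apply: differentiable_slice.
  move=> w wr; apply: HM; apply: in_box_update => //.
  by apply: in_box_le zr; lra.
have h2 : cabs (\sum_(j < N) F (update k0 (node R j) z) * (L j).[t] -
    polyfun (\sum_(j < N) p j * univariate (L j) k0) z) <= e / 2.
  rewrite polyfun_sum -sumrB.
  apply: le_trans (cabs_sum _) _.
  have -> : e / 2 = \sum_(j < N.+1) e / 2 / N.+1%:R.
    by rewrite sumr_const card_ord -[RHS]mulr_natr divfK // pnatr_eq0.
  rewrite big_ord_recr /= -[X in X <= _]addr0; apply: lerD; last by rewrite !divr_ge0 // ltW.
  apply: ler_sum => j _; rewrite polyfunM polyfun_univariate -mulrBl cabsM.
  have [b0 hb] := HB j.
  apply: (@le_trans _ _ (ee j * (B j + 1))); last by rewrite /ee divfK // gt_eqF // ltr_wpDl.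
  apply: ler_pM; rewrite ?cabs_ge0 ?Hp //.
  by apply: le_trans (hb _ (zr k0)) _; rewrite lerDl.
have := cabsD (F z - \sum_(j < N) F (update k0 (node R j) z) * (L j).[t])
  (\sum_(j < N) F (update k0 (node R j) z) * (L j).[t] -
    polyfun (\sum_(j < N) p j * univariate (L j) k0) z).
rewrite addrA subrK; lra.
Qed.

Lemma polynomial_approximation F r e : holomorphic F -> 0 <= r -> 0 < e ->
  exists p, forall z, in_box r z -> cabs (F z - polyfun p z) <= e.
Proof.
move=> hF r0 e0; apply: (@polynomial_approximation_partial n) => //.
by move=> z z' zz'; congr F; apply/colP => i; apply: zz'.
Qed.

End Approximation.

(** * Locally uniform limits of polynomials *)

Section Limits.
Variables (R : realType) (n : nat).
Local Notation C := (Cplx R).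
Local Notation poly_n := (mpoly n C).
Implicit Types (y v z : 'cV[C]_n) (p q : poly_n) (t w : C) (r s M e : R).

Lemma differentiable_horner (u : {poly C}) t : differentiable (horner u) t.
Proof.
elim/poly_ind: u => [|u c IH].
  have -> : horner (0 : {poly C}) = cst 0 by apply: funext => w; rewrite horner0.
  exact: differentiable_cst.
have -> : horner (u * 'X + c%:P) = horner u * id + cst c.
  by apply: funext => w; rewrite !hornerE.
apply: differentiableD; last exact: differentiable_cst.
apply: differentiableM => //; exact: (ex_diff (df := id)).
Qed.

Lemma horner_max_principle (u : {poly C}) r M t :
  (forall w, on_square r w -> cabs u.[w] <= M) -> in_square r t -> cabs u.[t] <= M.
Proof.
move=> bd tr; apply: (@max_principle R (horner u) [::] r M t) => //.
- by move=> w; apply: differentiable_continuous; apply: differentiable_horner.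
- by move=> w _; apply: differentiable_horner.
Qed.

(** The maximum principle applies to L + t u, and then to u: on the boundary,
    where |t| >= r, they are differences of known quantities divided by t. *)
Lemma quadratic_remainder_bound a L (u : {poly C}) r M : 0 < r ->
  (forall t, in_square r t -> cabs (a + t * L + t ^+ 2 * u.[t]) <= M) ->
  cabs L <= 2 * M / r /\ forall t, in_square r t -> cabs u.[t] <= 4 * M / r ^+ 2.
Proof.
move=> r0 bd.
have in0 : in_square r 0 by rewrite /in_square [cre _]/= [cim _]/= normr0 ltW.
have a_le : cabs a <= M by have := bd 0 in0; rewrite !mul0r expr0n /= mul0r !addr0.
have first t : in_square r t -> cabs (L%:P + 'X * u).[t] <= 2 * M / r.
  apply: horner_max_principle => w ow; have wr := on_square_cabs ow.
  rewrite ler_pdivlMr // hornerD hornerM hornerC hornerX.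
  have wS : in_square r w by case/andP: ow.
  apply: (@le_trans _ _ (cabs (w * (L + w * u.[w])))).
    by rewrite cabsM mulrC ler_wpM2r ?cabs_ge0.
  have -> : w * (L + w * u.[w]) = (a + w * L + w ^+ 2 * u.[w]) - a by ring.
  by apply: le_trans (cabsB _ _) _; have := bd w wS; lra.
have hL : cabs L <= 2 * M / r.
  by have := first 0 in0; rewrite hornerD hornerM hornerC hornerX mul0r addr0.
split => // t; apply: horner_max_principle => w ow; have wr := on_square_cabs ow.
have wS : in_square r w by case/andP: ow.
have -> : 4 * M / r ^+ 2 = (2 * (2 * M / r)) / r.
  by field; rewrite gt_eqF.
rewrite ler_pdivlMr //; apply: (@le_trans _ _ (cabs (w * u.[w]))).
  by rewrite cabsM mulrC ler_wpM2r ?cabs_ge0.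
have -> : w * u.[w] = (L%:P + 'X * u).[w] - L.
  by rewrite hornerD hornerM hornerC hornerX; ring.
by apply: le_trans (cabsB _ _) _; have := first w wS; lra.
Qed.

Definition dot (l : 'I_n -> C) v : C := \sum_i l i * v i ord0.

(** Such expansions multiply, with the linear part of a product given by
    Leibniz' rule. *)
Lemma line_expansion p y : exists l : 'I_n -> C, forall v, exists u : {poly C}, forall t,
  polyfun p (y + t *: v) = polyfun p y + t * dot l v + t ^+ 2 * u.[t].
Proof.
elim/mpoly_ring_ind: p => [c|i|p q [l Hl] [m Hm]|p q [l Hl] [m Hm]].
- exists (fun=> 0) => v; exists 0 => t.
  by rewrite !polyfunC /dot big1 ?horner0 ?mulr0 ?addr0 // => i _; rewrite mul0r.
- exists (fun j => (j == i)%:R) => v; exists 0 => t.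
  rewrite !polyfunX horner0 mulr0 addr0 !mxE /dot (bigD1 i) //= eqxx mul1r.
  by rewrite big1 ?addr0 // => j /negbTE ->; rewrite mul0r.
- exists (fun i => l i + m i) => v; have [u Hu] := Hl v; have [w Hw] := Hm v.
  exists (u + w) => t; rewrite !polyfunD Hu Hw hornerD.
  have -> : dot (fun i => l i + m i) v = dot l v + dot m v.
    by rewrite /dot -big_split; apply: eq_bigr => i _; rewrite mulrDl.
  ring.
- exists (fun i => polyfun p y * m i + polyfun q y * l i) => v.
  have [u Hu] := Hl v; have [w Hw] := Hm v.
  exists ((dot l v * dot m v)%:P + (polyfun p y)%:P * w + (polyfun q y)%:P * u +
          'X * ((dot l v)%:P * w + (dot m v)%:P * u) + 'X * ('X * (u * w))) => t.
  rewrite !polyfunM Hu Hw !(hornerD, hornerM, hornerC, hornerX).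
  have -> : dot (fun i => polyfun p y * m i + polyfun q y * l i) v =
      polyfun p y * dot m v + polyfun q y * dot l v.
    rewrite /dot !mulr_sumr -big_split; apply: eq_bigr => i _ /=; ring.
  ring.
Qed.

(** The intervals with centre x k and radius e k meet pairwise, so that they have
    a common point. *)
Lemma real_cauchy_limit (x : nat -> R) (e : nat -> R) :
  (forall k m, `|x k - x m| <= e k + e m) -> exists l, forall k, `|x k - l| <= e k.
Proof.
move=> hx; have h k m : x k - e k <= x m + e m.
  by have := hx k m; rewrite ler_norml => /andP[]; lra.
exists (sup (range (fun k => x k - e k))) => k.
have h1 : x k - e k <= sup (range (fun k => x k - e k)).
  by apply: ub_le_sup; [exists (x 0%N + e 0%N) => _ [m _ <-]|exists k].
have h2 : sup (range (fun k => x k - e k)) <= x k + e k.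
  by apply: ge_sup; [exists (x 0%N - e 0%N), 0%N|move=> _ [m _ <-]].
by rewrite ler_norml; apply/andP; split; lra.
Qed.

Lemma cauchy_limit (x : nat -> C) (e : nat -> R) :
  (forall k m, cabs (x k - x m) <= e k + e m) ->
  exists l, forall k, cabs (x k - l) <= 2 * e k.
Proof.
move=> hx.
have [a Ha] : exists l, forall k, `|cre (x k) - l| <= e k.
  by apply: real_cauchy_limit => k m; rewrite -creB; apply: le_trans (cre_le_cabs _) (hx k m).
have [b Hb] : exists l, forall k, `|cim (x k) - l| <= e k.
  by apply: real_cauchy_limit => k m; rewrite -cimB; apply: le_trans (cim_le_cabs _) (hx k m).
exists (cplx a b) => k; apply: le_trans (cabs_le_parts _) _; rewrite creB cimB /=.
by have := Ha k; have := Hb k; rewrite /cre /cim /=; lra.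
Qed.

Lemma le_of_le_harmonic (x a c : R) : 0 <= c ->
  (forall k : nat, x <= a + c * k.+1%:R^-1) -> x <= a.
Proof.
move=> c0 hx; rewrite leNgt; apply/negP => ax.
have d0 : 0 < x - a by lra.
have := archi_boundP (divr_ge0 c0 (ltW d0)); set k := Num.bound _ => hk.
have := hx k; apply/negP; rewrite -ltNge -ltrBrDl ltr_pdivrMr ?ltr0n //.
rewrite mulrC -ltr_pdivrMr //; apply: lt_le_trans hk _.
by rewrite ler_nat.
Qed.

Lemma cabs_coord_le_sum z i : cabs (z i ord0) <= \sum_j cabs (z j ord0).
Proof. by rewrite (bigD1 i) //= lerDl sumr_ge0 // => j _; apply: cabs_ge0. Qed.

Lemma differentiable_of_quadratic_bound (g : 'cV[C]_n -> C) y (l : 'I_n -> C) K :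
  (forall s v, 0 < s -> s <= 1 -> in_box s v ->
    cabs (g (y + v) - g y - dot l v) <= K * s ^+ 2) -> differentiable g y.
Proof.
move=> hg; pose df v := dot l v.
have dfE v : df v = polyfun (\sum_i constP n (l i) * coordX R i) v.
  by rewrite polyfun_sum; apply: eq_bigr => i _; rewrite polyfunM polyfunC polyfunX.
have dflin : linear df.
  move=> a u v; rewrite /df /dot scaler_sumr -big_split; apply: eq_bigr => i _.
  rewrite !mxE.
  have -> : a *: (l i * u i ord0) = a * (l i * u i ord0) by [].
  by rewrite mulrDr mulrCA.
pose dfM := GRing.isLinear.Build _ _ _ _ _ dflin.
pose dfL : {linear _ -> _} := HB.pack df dfM.
have dfc : continuous dfL.
  rewrite (_ : (dfL : 'cV[C]_n -> C) = polyfun (\sum_i constP n (l i) * coordX R i)).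
    exact: continuous_polyfun.
  by apply: funext => v; rewrite /= dfE.
have key : forall eps : C, 0 < eps -> \forall v \near (0 : 'cV[C]_n),
    `|g (v + y) - (g y + df v)| <= eps * `|v|.
  move=> eps eps0; have [epsE eps0'] := gt0_ofR eps0.
  pose K' := `|K| + 1; have K'0 : 0 < K' by rewrite ltr_wpDl.
  have KK' : K <= K' by rewrite /K'; have := ler_norm K; lra.
  pose d := Num.min (1 / 2) (cre eps / (4 * K')).
  have d0 : 0 < d by rewrite lt_min divr_gt0 //= divr_gt0 // mulr_gt0.
  apply/nbhs_ballP; exists (ofR d); first exact: ofR_gt0.
  move=> v; rewrite mx_norm_ball /ball_ /= sub0r normrN => vd.
  rewrite opprD addrA [v + y]addrC.
  have [->|v0] := eqVneq v 0.
    have -> : df 0 = 0 by rewrite /df /dot big1 // => i _; rewrite mxE mulr0.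
    by rewrite addr0 subr0 subrr normr0 mulr_ge0 // ltW.
  have vn : 0 < `|v| by rewrite normr_gt0.
  have [vE vn'] := gt0_ofR vn; set s := cre `|v| in vE vn'.
  move: vd; rewrite vE lt_ofR => vd.
  have sd1 : s <= 1 / 2 by apply: le_trans (ltW vd) _; rewrite ge_min lexx.
  have sd2 : s * (4 * K') <= cre eps.
    rewrite -ler_pdivlMr; last by rewrite mulr_gt0.
    by apply: le_trans (ltW vd) _; rewrite ge_min lexx orbT.
  (* the strict inequality |v| < 2 |v| places v in an open ball of the maximum norm *)
  have vb : in_box (2 * s) v.
    move=> i; apply: in_square_of_cabs; apply: ltW.
    have : ball (0 : 'cV[C]_n) (ofR (2 * s)) v.
      rewrite mx_norm_ball /ball_ /= sub0r normrN vE lt_ofR; lra.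
    by move=> [_ /(_ i ord0)]; rewrite mxE /ball /= sub0r normrN cabsE lt_ofR.
  rewrite cabsE epsE -ofRM le_ofR; apply: le_trans (hg _ _ _ _ vb) _; [lra|lra|].
  have -> : K * (2 * s) ^+ 2 = s * (4 * K) * s by ring.
  by rewrite ler_pM2r //; apply: le_trans sd2; rewrite ler_pM2l //; lra.
have o := (proj2 (@eqaddoP C 'cV[C]_n C 'cV[C]_n (nbhs_filter_on (0 : 'cV[C]_n))
  (fun v => g (v + y)) (cst (g y) + dfL) id)) key.
apply/(@diff_locallyP C 'cV[C]_n C y g).
by rewrite (diff_unique dfc o); split; [exact: dfc|exact: o].
Qed.

(** The linear parts at y of the approximating polynomials form a Cauchy
    sequence, by [quadratic_remainder_bound] for their differences, and their
    quadratic remainders are uniformly at most 4 M s ^ 2.  Both statements pass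
    to the limit. *)
Lemma locally_uniform_limit_holomorphic (g : 'cV[C]_n -> C) :
  (forall A e, 0 < e -> exists p, forall y, in_box A y -> cabs (g y - polyfun p y) <= e) ->
  holomorphic g.
Proof.
move=> happ y.
pose B := \sum_i cabs (y i ord0); pose A := B + 4.
pose ep (k : nat) : R := k.+1%:R^-1.
have ep0 k : 0 < ep k by rewrite invr_gt0 ltr0n.
have ep1 k : ep k <= 1 by rewrite invf_le1 ?ltr0n // ler1n.
(* A leaves room for the points y + t v with v in the box of size s and t in
   the square of size 1 / s, where |t v_i| <= 4 *)
have [P HP] := boolp.choice (fun k => happ A (ep k) (ep0 k)).
have [M0 HM0] := bounded_on_box A (continuous_polyfun (p := P 0)).
pose M := `|M0| + 2.
have HM k z (zA : in_box A z) : cabs (polyfun (P k) z) <= M.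
  have h1 := le_trans (HP k z zA) (ep1 k); have h2 := le_trans (HP 0 z zA) (ep1 0).
  have h3 := HM0 z zA.
  have h4 := cabsB (g z) (g z - polyfun (P k) z); rewrite subKr in h4.
  have h5 := cabsD (g z - polyfun (P 0) z) (polyfun (P 0) z); rewrite subrK in h5.
  apply: le_trans h4 _; rewrite /M (_ : `|M0| + 2 = 1 + `|M0| + 1); last by ring.
  by apply: lerD h1; apply: le_trans h5 (lerD h2 (le_trans h3 (ler_norm _))).
have [l Hl] := boolp.choice (fun k => line_expansion (P k) y).
have inA s v t : 0 < s -> in_box s v -> in_square (1 / s) t -> in_box A (y + t *: v).
  move=> s0 vs ts i; apply: in_square_of_cabs; rewrite !mxE.
  apply: le_trans (cabsD _ _) _; rewrite /A; apply: lerD.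
    exact: cabs_coord_le_sum.
  rewrite cabsM; have -> : 4 = (2 * (1 / s)) * (2 * s) by field; rewrite gt_eqF.
  by apply: ler_pM; rewrite ?cabs_ge0 ?in_square_cabs.
have dl k m s v : 0 < s -> in_box s v ->
    cabs (dot (l k) v - dot (l m) v) <= 2 * (ep k + ep m) * s.
  move=> s0 vs; have [u Hu] := Hl k v; have [w Hw] := Hl m v.
  have r0 : 0 < 1 / s by rewrite divr_gt0.
  have [|h _] := @quadratic_remainder_bound (polyfun (P k) y - polyfun (P m) y)
    (dot (l k) v - dot (l m) v) (u - w) _ (ep k + ep m) r0.
    move=> t ts; have zA := inA s v t s0 vs ts.
    have -> : polyfun (P k) y - polyfun (P m) y + t * (dot (l k) v - dot (l m) v) +
        t ^+ 2 * (u - w).[t] = (g (y + t *: v) - polyfun (P m) (y + t *: v)) -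
        (g (y + t *: v) - polyfun (P k) (y + t *: v)).
      by rewrite Hu Hw hornerD hornerN; ring.
    by apply: le_trans (cabsB _ _) _; rewrite addrC lerD ?HP.
  by apply: le_trans h _; rewrite div1r invrK.
have cl i k m : cabs (l k i - l m i) <= 2 * ep k + 2 * ep m.
  have := @dl k m 1 (delta_mx i ord0) ltr01; rewrite mulr1 mulrDr.
  have dE (a : 'I_n -> C) : dot a (delta_mx i ord0) = a i.
    rewrite /dot (bigD1 i) //= mxE !eqxx mulr1 big1 ?addr0 // => j /negbTE ne.
    by rewrite mxE ne mulr0.
  rewrite !dE; apply => j; apply: in_square_of_cabs; rewrite mxE.
  case: (_ && _); first by rewrite -le_ofR -cabsE normr1.
  by rewrite -le_ofR -cabsE normr0 le_ofR.
have [lim Hlim] := boolp.choice (fun i => cauchy_limit (cl i)).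
apply: (@differentiable_of_quadratic_bound g y lim (4 * M)) => s v s0 s1 vs.
have t1 : in_square (1 / s) 1.
  by apply: in_square_of_cabs; rewrite -le_ofR -cabsE normr1 le_ofR ler_pdivlMr ?mul1r.
have t0 : in_square (1 / s) 0.
  by apply: in_square_of_cabs; rewrite -le_ofR -cabsE normr0 le_ofR divr_ge0 // ltW.
apply: (@le_of_le_harmonic _ _ (2 + \sum_i 4 * cabs (v i ord0))) => [|k].
  by rewrite addr_ge0 // sumr_ge0 // => i _; rewrite mulr_ge0 ?cabs_ge0.
have [u Hu] := Hl k v.
have r0 : 0 < 1 / s by rewrite divr_gt0.
have [|_ hu] := @quadratic_remainder_bound (polyfun (P k) y) (dot (l k) v) u _ M r0.
  by move=> t ts; rewrite -Hu; apply: HM; apply: inA ts.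
have yv : in_box A (y + v) by rewrite -[v]scale1r; apply: inA t1.
have yy : in_box A y by have := inA s v 0 s0 vs t0; rewrite scale0r addr0.
have h1 := HP k _ yv; have h2 := HP k _ yy; have h3 := hu 1 t1.
have h4 : cabs (dot (l k) v - dot lim v) <= (\sum_i 4 * cabs (v i ord0)) * ep k.
  rewrite /dot -sumrB mulr_suml; apply: le_trans (cabs_sum _) _.
  apply: ler_sum => i _; rewrite -mulrBl cabsM mulrAC ler_wpM2r ?cabs_ge0 //.
  by apply: le_trans (Hlim i k) _; rewrite mulrA -natrM.
have := Hu 1; rewrite scale1r mul1r expr1n mul1r => E.
have -> : g (y + v) - g y - dot lim v = (g (y + v) - polyfun (P k) (y + v)) -
   (g y - polyfun (P k) y) + u.[1] + (dot (l k) v - dot lim v) by rewrite E; ring.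
have h3' : cabs u.[1] <= 4 * M * s ^+ 2.
  by apply: le_trans h3 _; rewrite div1r exprVn invrK.
have h5 := cabsB (g (y + v) - polyfun (P k) (y + v)) (g y - polyfun (P k) y).
have -> : 4 * M * s ^+ 2 + (2 + \sum_i 4 * cabs (v i ord0)) * k.+1%:R^-1 =
    ep k + ep k + 4 * M * s ^+ 2 + (\sum_i 4 * cabs (v i ord0)) * ep k.
  by rewrite -/(ep k); ring.
apply: le_trans (cabsD _ _) _; apply: le_trans (lerD (cabsD _ _) (lexx _)) _.
exact: lerD (lerD (le_trans h5 (lerD h1 h2)) h3') h4.
Qed.

End Limits.

(** * The quotient map and descent *)

Section Descent.
Variables (R : realType) (n : nat).
Local Notation C := (Cplx R).
Local Notation poly_n := (mpoly n C).
Variables (G : set 'M[C]_n) (theta : n.-tuple poly_n).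
Hypotheses (grpG : matrix_group G) (finG : finite_set G) (hsopG : hsop G theta).
Implicit Types (y v z x c : 'cV[C]_n) (p q : poly_n) (a rho : 'M[C]_n).
Implicit Types (r s M e : R).

Lemma monic_root_bound (r : nat -> R) (m : nat) (t : R) : 0 <= t ->
  (forall k, 0 <= r k) -> t ^+ m.+1 <= \sum_(k < m.+1) r k * t ^+ k ->
  t <= 1 + \sum_(k < m.+1) r k.
Proof.
move=> t0 r0 ht; have S0 : 0 <= \sum_(k < m.+1) r k by apply: sumr_ge0.
have [t1|t1] := leP t 1; first by lra.
suff : t <= \sum_(k < m.+1) r k by lra.
have tm : 0 < t ^+ m by rewrite exprn_gt0 //; lra.
rewrite -(ler_pM2r tm) -exprS; apply: le_trans ht _.
rewrite mulr_suml; apply: ler_sum => k _; rewrite ler_wpM2l //.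
by apply: ler_weXn2l; [exact: ltW|rewrite -ltnS].
Qed.

Lemma polyfun_comp (t : n.-tuple poly_n) q z :
  polyfun (comp_mpoly t q) z = polyfun q (thetamap t z).
Proof.
rewrite /polyfun comp_mpoly_meval; apply: meval_eq => i.
by rewrite mxE.
Qed.

Definition linear_form a (j : 'I_n) : poly_n := \sum_k constP n (a j k) * coordX R k.

Lemma polyfun_linear_form a j z : polyfun (linear_form a j) z = (a *m z) j ord0.
Proof.
rewrite /linear_form polyfun_sum mxE; apply: eq_bigr => k _.
by rewrite polyfunM polyfunC polyfunX.
Qed.

Lemma polyfun_precomp p a : exists q, forall z, polyfun q z = polyfun p (a *m z).
Proof.
exists (comp_mpoly [tuple linear_form a j | j < n] p) => z.
rewrite polyfun_comp; congr polyfun; apply/colP => j.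
by rewrite mxE tnth_mktuple polyfun_linear_form.
Qed.

Lemma invariant_polyE p : G_invariant G (polyfun p) ->
  exists q, forall z, polyfun p z = polyfun q (thetamap theta z).
Proof.
have [_ _ _ E] := hsopG; move=> cim.
have : invariant_polys G p by [].
by rewrite E => -[q _ <-]; exists q => z; rewrite polyfun_comp.
Qed.

Lemma group_enumeration : exists gs : seq 'M[C]_n,
  [/\ uniq gs, 1%:M \in gs & forall a, a \in gs <-> G a].
Proof.
have [_ G1 _ _] := grpG.
have [s Es] := (proj1 (finite_seqP G)) finG.
have sG a : a \in undup s <-> G a by rewrite mem_undup Es.
by exists (undup s); rewrite undup_uniq; split => //; apply/sG.
Qed.

(** Right translation by an element of G permutes G. *)
Lemma big_translate (T : Type) (idx : T) (op : Monoid.com_law idx) (gs : seq 'M[C]_n)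
    (F : 'M[C]_n -> T) rho : uniq gs -> (forall a, a \in gs <-> G a) -> G rho ->
  \big[op/idx]_(a <- gs) F (a *m invmx rho) = \big[op/idx]_(a <- gs) F a.
Proof.
move=> ugs gsG Grho; have [Gu _ GM GV] := grpG.
rewrite -(big_map (fun a => a *m invmx rho) xpredT F); apply: perm_big.
have inj : injective (fun a => a *m invmx rho).
  by move=> a b /(congr1 (mulmx^~ rho)); rewrite -!mulmxA mulVmx ?mulmx1 ?Gu.
apply: uniq_perm => //; first by rewrite map_inj_uniq.
apply: (uniq_min_size _ _ _).2; first by rewrite map_inj_uniq.
  by move=> _ /mapP [a /gsG Ga ->]; apply/gsG; apply: GM (GV _ Grho).
by rewrite size_map.
Qed.

Lemma orbit_sum_polyE (gs : seq 'M[C]_n) p : uniq gs -> (forall a, a \in gs <-> G a) ->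
  exists q, forall z, \sum_(a <- gs) polyfun p (a *m z) = polyfun q (thetamap theta z).
Proof.
move=> ugs gsG.
have [ap Hap] := boolp.choice (polyfun_precomp p).
have E z : polyfun (\sum_(a <- gs) ap a) z = \sum_(a <- gs) polyfun p (a *m z).
  by rewrite polyfun_sum; apply: eq_bigr => a _.
have [q Hq] : exists q, forall z, polyfun (\sum_(a <- gs) ap a) z = polyfun q (thetamap theta z).
  apply: invariant_polyE => rho Grho z; rewrite !E.
  under eq_bigr do rewrite mulmxA.
  exact: (big_translate _ (fun a => polyfun p (a *m z)) ugs gsG Grho).
by exists q => z; rewrite -Hq E.
Qed.

(** An element of G permutes the factors of the product, so that its
    coefficients are invariant polynomials. *)
Lemma orbit_coordinate_poly (gs : seq 'M[C]_n) (j : 'I_n) :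
  uniq gs -> (forall a, a \in gs <-> G a) ->
  exists q : nat -> poly_n, forall z,
    \prod_(a <- gs) ('X - ((a *m z) j ord0)%:P) =
    \poly_(k < (size gs).+1) polyfun (q k) (thetamap theta z).
Proof.
move=> ugs gsG.
pose P : {poly poly_n} := \prod_(a <- gs) ('X - (linear_form a j)%:P).
have PE z : map_poly (fun p => polyfun p z) P =
    \prod_(a <- gs) ('X - ((a *m z) j ord0)%:P).
  rewrite -[LHS]/(map_poly (meval (fun i => z i ord0)) P) rmorph_prod.
  apply: eq_bigr => a _; rewrite rmorphB /= map_polyX map_polyC /=.
  by rewrite -[meval _ _]/(polyfun _ z) polyfun_linear_form.
have PcE k z : polyfun P`_k z = (\prod_(a <- gs) ('X - ((a *m z) j ord0)%:P))`_k.
  by rewrite -PE -[LHS]/(meval (fun i => z i ord0) _) -coef_map.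
have Pinv k : exists q, forall z, polyfun P`_k z = polyfun q (thetamap theta z).
  apply: invariant_polyE => rho Grho z; rewrite !PcE; congr (nth 0 (polyseq _) k).
  under eq_bigr do rewrite mulmxA.
  exact: (@big_translate {poly C} 1 *%R gs (fun a => 'X - ((a *m z) j ord0)%:P) rho ugs gsG Grho).
have [q Hq] := boolp.choice Pinv.
exists q => z; apply/polyP => k; rewrite coef_poly -Hq PcE; case: ltnP => // kn.
by rewrite nth_default // size_prod_XsubC.
Qed.

(** The factor of the identity matrix in [orbit_coordinate_poly] vanishes at
    z_j. *)
Lemma coordinate_integral (j : 'I_n) : exists (m : nat) (q : nat -> poly_n), forall z,
  z j ord0 ^+ m.+1 =
  \sum_(k < m.+1) polyfun (q k) (thetamap theta z) * z j ord0 ^+ k.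
Proof.
have [gs [ugs g1 gsG]] := group_enumeration.
have [q Hq] := orbit_coordinate_poly j ugs gsG.
case Em : (size gs) => [|m]; first by move: g1; rewrite (size0nil Em).
exists m, (fun k => - q k) => z.
have := congr1 (horner^~ (z j ord0)) (Hq z).
rewrite (big_rem _ g1) /= mul1mx hornerM !hornerE subrr mul0r horner_poly Em.
rewrite big_ord_recr /= => /esym/eqP; rewrite addrC addr_eq0 => /eqP.
have -> : polyfun (q m.+1) (thetamap theta z) = 1.
  have := congr1 (fun u : {poly C} => u`_m.+1) (Hq z).
  rewrite coef_poly Em ltnS leqnn => <-.
  have /monicP := monic_prod_XsubC gs xpredT (fun a => (a *m z) j ord0).
  by rewrite lead_coefE size_prod_XsubC Em.
rewrite mul1r => ->; rewrite -sumrN; apply: eq_bigr => k _.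
by rewrite [polyfun (- q k) _]mevalN mulNr.
Qed.

(** By [coordinate_integral], the coordinates of z are roots of monic polynomials
    whose coefficients are bounded when theta (z) is. *)
Lemma thetamap_proper (A : R) : exists2 B : R, 0 <= B &
  forall z, in_box A (thetamap theta z) -> in_box B z.
Proof.
have coord (j : 'I_n) : exists2 B : R, 0 <= B &
    forall z, in_box A (thetamap theta z) -> cabs (z j ord0) <= B.
  have [m [q Hq]] := coordinate_integral j.
  have hb k : exists b : R, 0 <= b /\ forall y, in_box A y -> cabs (polyfun (q k) y) <= b.
    have [b hb] := bounded_on_box A (continuous_polyfun (p := q k)).
    exists `|b|; split => // y Ay; exact: le_trans (hb y Ay) (ler_norm _).
  have [b Hb] := boolp.choice hb.
  exists (1 + \sum_(k < m.+1) b k); last move=> z Az.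
    by apply: addr_ge0 => //; apply: sumr_ge0 => k _; have [] := Hb k.
  apply: (@monic_root_bound b m); first exact: cabs_ge0.
    by move=> k; have [] := Hb k.
  rewrite -cabsX Hq; apply: le_trans (cabs_sum _) _.
  apply: ler_sum => k _; rewrite cabsM cabsX ler_wpM2r ?exprn_ge0 ?cabs_ge0 //.
  by have [_] := Hb k; apply.
have hc j : exists B : R, 0 <= B /\
    forall z, in_box A (thetamap theta z) -> cabs (z j ord0) <= B.
  by have [B h1 h2] := coord j; exists B.
have [B HB] := boolp.choice hc.
have B0 i : 0 <= B i by have [] := HB i.
exists (\sum_i B i) => [|z Az i]; first by apply: sumr_ge0.
have zi : cabs (z i ord0) <= \sum_i B i.
  have [_ h] := HB i; apply: le_trans (h z Az) _.
  by rewrite (bigD1 i) //= lerDl sumr_ge0.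
by apply/andP; split; apply: le_trans zi; [apply: cre_le_cabs|apply: cim_le_cabs].
Qed.

(** The polynomials sum_i a_i (theta_i - c_i) form an ideal I, which contains
    q o theta - q (c) for all q.  A common zero of I is a preimage of c, and
    [coordinate_integral] provides the polynomials in one variable that
    [zero_of_proper_ideal] requires. *)
Lemma thetamap_surjective c : exists z, thetamap theta z = c.
Proof.
have [gs [ugs g1 gsG]] := group_enumeration.
pose I : set poly_n := [set p | exists a : 'I_n -> poly_n, forall z,
  polyfun p z = \sum_i polyfun (a i) z * (thetamap theta z i ord0 - c i ord0)].
have ID p q : I p -> I q -> I (p + q).
  move=> [a Ha] [b Hb]; exists (fun i => a i + b i) => z.
  rewrite polyfunD Ha Hb -big_split; apply: eq_bigr => i _.
  by rewrite polyfunD mulrDl.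
have IM p q : I q -> I (p * q).
  move=> [a Ha]; exists (fun i => p * a i) => z.
  rewrite polyfunM Ha mulr_sumr; apply: eq_bigr => i _.
  by rewrite polyfunM mulrA.
have size0 : (size gs)%:R != 0 :> C.
  by rewrite pnatr_eq0 size_eq0; apply: contraTneq g1 => ->.
(* summing 1 = sum_i a_i (theta_i - c_i) over the orbits replaces the a_i by
   polynomials b_i in theta and 1 by the order of G; algebraic independence
   allows to evaluate at c instead of theta (z) *)
have I1 : ~ I 1.
  move=> [a Ha].
  have hb i : exists b, forall z, \sum_(s <- gs) polyfun (a i) (s *m z) =
     polyfun b (thetamap theta z) by apply: orbit_sum_polyE.
  have [b Hb] := boolp.choice hb.
  have [_ thinv indep _] := hsopG.
  pose q := \sum_i b i * (coordX R i - constP n (c i ord0)) - constP n (size gs)%:R.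
  have q0 : q = 0.
    apply: indep; apply: polyfun_eq0 => z.
    rewrite polyfun_comp polyfunB polyfunC polyfun_sum.
    apply/eqP; rewrite subr_eq0; apply/eqP.
    transitivity (\sum_(s <- gs) polyfun 1 (s *m z)).
      under [RHS]eq_bigr do rewrite Ha.
      rewrite exchange_big; apply: eq_bigr => i _.
      rewrite polyfunM polyfunB polyfunX polyfunC -Hb mulr_suml.
      rewrite big_seq [RHS]big_seq; apply: eq_bigr => s /gsG Gs.
      congr (_ * (_ - _)); rewrite !mxE.
      have [_ _ _ GV] := grpG; have := thinv i (invmx s) (GV s Gs) z.
      by rewrite invmxK.
    have -> : (1 : poly_n) = constP n 1 by rewrite /constP mpolyC1.
    under eq_bigr do rewrite polyfunC.
    by rewrite big_const_seq count_predT iter_addr_0.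
  have := congr1 (fun p => polyfun p c) q0.
  rewrite polyfunB polyfunC polyfun_sum big1 => [|i _].
    rewrite sub0r /= (_ : polyfun 0 c = 0); last exact: meval0.
    by move/eqP; rewrite oppr_eq0 (negbTE size0).
  by rewrite polyfunM polyfunB polyfunX polyfunC subrr mulr0.
have Ival q d z : polyfun (comp_mpoly theta q - constP n d) z =
    polyfun q (thetamap theta z) - d.
  by rewrite polyfunB polyfun_comp polyfunC.
have I0 p : (forall z, polyfun p z = 0) -> I p.
  move=> p0; exists (fun _ => 0) => z; rewrite p0 big1 // => i _.
  by rewrite (_ : polyfun 0 z = 0) ?mul0r //; apply: meval0.
have Itheta q : I (comp_mpoly theta q - constP n (polyfun q c)).
  have Iext p p' : (forall z, polyfun p z = polyfun p' z) -> I p -> I p'.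
    by move=> e [a Ha]; exists a => z; rewrite -e Ha.
  elim/mpoly_ring_ind: q => [d|i|q1 q2 h1 h2|q1 q2 h1 h2].
  - by apply: I0 => z; rewrite polyfunB polyfun_comp !polyfunC subrr.
  - exists (fun k => constP n (k == i)%:R) => z.
    rewrite polyfunB polyfunC polyfun_comp !polyfunX (bigD1 i) //= polyfunC eqxx mul1r.
    by rewrite big1 ?addr0 // => k /negbTE ne; rewrite polyfunC ne mul0r.
  - apply: Iext (ID _ _ h1 h2) => z.
    by rewrite Ival [LHS]polyfunD !Ival !(polyfunD q1 q2) opprD addrACA.
  - apply: Iext (ID _ _ (IM (comp_mpoly theta q1) _ h2) (IM (constP n (polyfun q2 c)) _ h1)) => z.
    rewrite Ival [LHS]polyfunD (polyfunM (comp_mpoly _ _)) (polyfunM (constP _ _)).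
    rewrite !Ival polyfunC polyfun_comp !(polyfunM q1 q2).
    have alg (a b d e : C) : a * (b - e) + e * (a - d) = a * b - d * e by ring.
    exact: alg.
have Iu i : exists2 u : {poly C}, u != 0 & I (univariate u i).
  have [m [q Hq]] := coordinate_integral i.
  pose u : {poly C} := 'X^(m.+1) - \poly_(k < m.+1) polyfun (q k) c.
  exists u.
    have u1 : u`_m.+1 = 1 by rewrite coefB coefXn coef_poly eqxx ltnn subr0.
    by apply: contra_eq_neq u1 => ->; rewrite coef0 eq_sym oner_neq0.
  have -> : univariate u i = \sum_(k < m.+1)
      coordX R i ^+ k * (comp_mpoly theta (q k) - constP n (polyfun (q k) c)).
    apply/eqP; rewrite -subr_eq0; apply/eqP; apply: polyfun_eq0 => z.
    rewrite polyfunB polyfun_univariate polyfun_sum /u hornerD hornerN hornerXn Hq.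
    rewrite horner_poly -!sumrB big1 // => k _.
    rewrite polyfunM polyfunB polyfunC polyfun_comp.
    have -> : polyfun (coordX R i ^+ k) z = z i ord0 ^+ k.
      by rewrite -(polyfunX i z) -[LHS]/(meval _ _) rmorphXn.
    by ring.
  elim/big_rec: _ => [|k p _ Ip]; first by apply: I0 => z; apply: meval0.
  by apply: ID Ip; apply: IM.
have [x Hx] := zero_of_proper_ideal ID IM I1 Iu.
exists x; apply/colP => i.
have := Hx _ (Itheta (coordX R i)).
by rewrite polyfunB polyfun_comp polyfunC !polyfunX => /eqP; rewrite subr_eq0 => /eqP.
Qed.

(** Averaging over G leaves f unchanged and does not increase the distance of f
    to the approximating polynomial. *)
Lemma invariant_approximation (f : 'cV[C]_n -> C) B e : G_invariant G f -> holomorphic f ->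
  0 <= B -> 0 < e -> exists q, forall z, in_box B z ->
    cabs (f z - polyfun q (thetamap theta z)) <= e.
Proof.
move=> Gf hf B0 e0; have [gs [ugs g1 gsG]] := group_enumeration.
pose row_bound (a : 'M[C]_n) : R := \sum_j \sum_k cabs (a j k) * (2 * B).
have row0 a j : 0 <= \sum_k cabs (a j k) * (2 * B).
  by apply: sumr_ge0 => k _; rewrite mulr_ge0 ?cabs_ge0 ?mulr_ge0.
have rb0 a : 0 <= row_bound a by apply: sumr_ge0.
pose B' := \sum_(a <- gs) row_bound a.
have inB' a z : a \in gs -> in_box B z -> in_box B' (a *m z).
  move=> ags zB j; apply: in_square_of_cabs; rewrite mxE.
  apply: le_trans (cabs_sum _) _; rewrite /B' [leRHS](big_rem _ ags) /=.
  apply: (@le_trans _ _ (row_bound a)); last by rewrite lerDl sumr_ge0.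
  rewrite /row_bound [leRHS](bigD1 j) //=.
  apply: (@le_trans _ _ (\sum_k cabs (a j k) * (2 * B))).
    apply: ler_sum => k _; rewrite cabsM ler_wpM2l ?cabs_ge0 //.
    exact: in_square_cabs.
  by rewrite lerDl sumr_ge0.
have B'0 : 0 <= B' by apply: sumr_ge0.
have [p Hp] := polynomial_approximation hf B'0 e0.
have [q Hq] := orbit_sum_polyE p ugs gsG.
have N0 : 0 < (size gs)%:R :> R.
  by rewrite ltr0n; case: (gs) g1.
have sN : (size gs)%:R != 0 :> C by rewrite pnatr_eq0 size_eq0; case: (gs) g1.
exists (constP n (size gs)%:R^-1 * q) => z zB.
rewrite polyfunM polyfunC -Hq.
have fz : f z = (size gs)%:R^-1 * \sum_(a <- gs) f (a *m z).
  rewrite big_seq (eq_bigr (fun _ => f z)) => [|a /gsG Ga]; last first.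
    by have [_ _ _ GV] := grpG; rewrite -[a in LHS]invmxK; apply: Gf; apply: GV.
  by rewrite -big_seq big_const_seq count_predT iter_addr_0 -[f z *+ _]mulr_natl mulKf.
rewrite {1}fz -mulrBr -sumrB cabsM.
have cN : cabs ((size gs)%:R^-1 : C) = (size gs)%:R^-1.
  have -> : ((size gs)%:R^-1 : C) = ofR (size gs)%:R^-1.
    by rewrite /ofR -[cplx _ 0]/((_ : R)%:C)%C fmorphV rmorph_nat.
  by rewrite cabs_ofR // invr_ge0 ler0n.
rewrite cN mulrC ler_pdivrMr //.
apply: (@le_trans _ _ (\sum_(a <- gs) cabs (f (a *m z) - polyfun p (a *m z)))).
  elim/big_ind2: _ => [|x1 x2 y1 y2 h1 h2|//]; first by rewrite le_eqVlt cabs_eq0 eqxx.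
  by apply: le_trans (cabsD _ _) (lerD h1 h2).
rewrite mulr_natr -iter_addr_0 -count_predT -big_const_seq big_seq [leRHS]big_seq.
by apply: ler_sum => a ags; apply: Hp; apply: inB'.
Qed.

(** Polynomials in theta approximate f uniformly on boxes, so that f is constant
    on the fibres of theta and its composition with any section of theta is a
    locally uniform limit of polynomials, theta being proper. *)
Lemma invariant_holomorphic_descent (f : 'cV[C]_n -> C) : G_invariant G f -> holomorphic f ->
  exists g, holomorphic g /\ f = g \o thetamap theta.
Proof.
move=> Gf hf.
have [sec Hsec] := boolp.choice thetamap_surjective.
exists (fun y => f (sec y)); split.
  apply: locally_uniform_limit_holomorphic => A e e0.
  have [B B0 HB] := thetamap_proper A.
  have [q Hq] := invariant_approximation Gf hf B0 e0.
  exists q => y yA; rewrite -{2}(Hsec y); apply: Hq.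
  by apply: HB; rewrite Hsec.
apply: funext => z /=; set z' := sec _.
have tz : thetamap theta z' = thetamap theta z by rewrite Hsec.
pose B := \sum_j cabs (z j ord0) + \sum_j cabs (z' j ord0).
have S0 (x : 'cV[C]_n) : 0 <= \sum_j cabs (x j ord0).
  by apply: sumr_ge0 => j _; apply: cabs_ge0.
have B0 : 0 <= B by rewrite addr_ge0.
have zB : in_box B z.
  move=> i; apply: in_square_of_cabs; apply: le_trans (cabs_coord_le_sum _ _) _.
  by rewrite lerDl.
have z'B : in_box B z'.
  move=> i; apply: in_square_of_cabs; apply: le_trans (cabs_coord_le_sum _ _) _.
  by rewrite lerDr.
apply/eqP; rewrite -subr_eq0 -cabs_eq0 eq_le cabs_ge0 andbT.
apply: (@le_of_le_harmonic R _ _ 2) => // k; rewrite add0r.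
have e0 : 0 < k.+1%:R^-1 :> R by rewrite invr_gt0 ltr0n.
have [q Hq] := invariant_approximation Gf hf B0 e0.
have h1 := Hq z zB; have h2 := Hq z' z'B; rewrite tz in h2.
have -> : f z - f z' = (f z - polyfun q (thetamap theta z)) -
  (f z' - polyfun q (thetamap theta z)) by ring.
by apply: le_trans (cabsB _ _) _; rewrite mulr_natl mulr2n lerD.
Qed.

End Descent.

Theorem theorem3p1 (R : realType) (n : nat) (G : set 'M[Cplx R]_n)
    (theta : n.-tuple (mpoly n (Cplx R))) :
  finite_pseudoreflection_group G ->
  hsop G theta ->
  forall f : 'cV[Cplx R]_n -> Cplx R,
    G_invariant G f -> holomorphic f ->
    exists! g : 'cV[Cplx R]_n -> Cplx R,
      holomorphic g /\ f = g \o thetamap theta.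
Proof.
move=> [grpG finG _] hsopG f Gf hf.
have [g [hg fE]] := invariant_holomorphic_descent grpG finG hsopG Gf hf.
exists g; split=> [//|g' [_ fE']]; apply: funext => y.
have [z <-] := thetamap_surjective grpG finG hsopG y.
by rewrite -[g _]/((g \o thetamap theta) z) -fE fE'.
Qed.
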